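(* Let $w_0\in H^2(0,1)$ and let $w$ be the solution of the closed-loop problem described in the context, with $\alpha$, $E_1$, $E_3$ as in the context. Then there is a constant $C>0$, independent of $t$, such that for all $t>0$ $$\nu\|w_{xx}(t)\|^2+e^{-2\alpha t}\int_0^t e^{2\alpha s}\Big(\|w_{xt}(s)\|^2+\mu\|w_{xxt}(s)\|^2+\frac{2}{\nu}E_3(w)(s)\Big)\,ds\le Ce^{C}e^{-2\alpha t}\Big(C(1+\mu)\big(\|w_0\|_2^2+E_1(w)(0)\big)\Big).$$
   Context: Constants: $\mu>0$, $\nu>0$, $w_d\ge 0$, $c_0>0$, $c_1>0$ (fixed, as is $w_0$). $\|\cdot\|$ and $(\cdot,\cdot)$ are the norm and inner product of $L^2(0,1)$; $\|\cdot\|_m$ is the $H^m(0,1)$ norm; subscripts $x,t$ denote partial derivatives. Closed-loop problem: $w=w(x,t)$, $x\in(0,1)$, $t>0$, satisfies $$w_t-\mu w_{xxt}-\nu w_{xx}+(1+w_d)w_x+ww_x=0,\qquad w(x,0)=w_0(x),$$ with boundary feedback laws $$w_x(0,t)=\frac1\nu\Big((c_0+1+w_d)w(0,t)+\frac{2}{9c_0}w^3(0,t)\Big),\qquad w_x(1,t)=-\frac1\nu\Big((c_1+1+w_d)w(1,t)+\frac{2}{9c_1}w^3(1,t)\Big).$$ Standing well-posedness assumption: for $w_0\in H^2(0,1)$ there is a unique weak solution with $w(t)\in H^1(0,1)$, $w_t\in L^2(L^2)$, $\mu w_t\in L^2(H^1)$, and it satisfies $\|w(t)\|_2^2+\|w_t(t)\|^2+\mu\|w_{xt}(t)\|^2+\int_0^t(\|w_t(s)\|_1^2+\mu\|w_{xxt}(s)\|^2)\,ds\le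 C$. The number $\alpha$ is any real with $$0\le\alpha\le\frac12\min\Big\{\frac{\nu}{\mu+1},\ \frac{\nu}{2\mu+\nu},\ \frac{\nu(1+c_i+w_d)}{\nu+(1+c_i+w_d)\mu}\ (i=0,1)\Big\},$$ and $$E_1(w)(t)=\sum_{i=0}^{1}\Big((c_i+1+w_d)+\frac{1}{3c_i}w^2(i,t)\Big)w^2(i,t),\qquad E_3(w)(t)=\sum_{i=0}^{1}\Big((1+c_i+w_d)+\frac{2}{3c_i}w^2(i,t)\Big)w_t^2(i,t).$$ *)

(* Defs.v *)
From HB Require Import structures.
From mathcomp Require Import all_boot all_order all_algebra.
From mathcomp Require Import all_classical all_reals all_analysis.
Set Implicit Arguments.
Unset Strict Implicit.
Unset Printing Implicit Defensive.
Import Order.TTheory GRing.Theory Num.Theory.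
Import numFieldNormedType.Exports.
Local Open Scope classical_set_scope.
Local Open Scope ring_scope.

Definition test_function (R : realType) (I : set R) (phi : R -> R) : Prop :=
  [/\ forall x, derivable phi x 1,
      continuous (derive1 phi) &
      exists K : set R, [/\ compact K, K `<=` I & forall x, ~ K x -> phi x = 0]].

(* g is the weak (distributional) derivative of f on the open set I.  As usual
   in dimension one the test functions are C^1_c; C^oo_c gives the same notion. *)
Definition weak_derivative (R : realType) (I : set R) (f g : R -> R) : Prop :=
  [/\ locally_integrable I f,
      locally_integrable I g &
      forall phi, test_function I phi ->
        Rintegral lebesgue_measure I (fun x => f x * derive1 phi x) =
        - Rintegral lebesgue_measure I (fun x => g x * phi x)].

Section SpaceNorms.
Variable R : realType.
Implicit Types f fx fxx g : R -> R.

Definition L2sq f : \bar R :=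
  (\int[lebesgue_measure]_(x in `]0%R, 1%R[) ((f x ^+ 2)%:E))%E.

Definition L2ip f g : R :=
  Rintegral lebesgue_measure `]0, 1[ (fun x => f x * g x).

Definition in_L2 f : Prop :=
  measurable_fun (`]0, 1[ : set R) f /\ (L2sq f < +oo)%E.

(* The weak derivatives are passed explicitly; they are unique almost everywhere. *)
Definition in_H1 f fx : Prop :=
  [/\ in_L2 f, in_L2 fx & weak_derivative `]0, 1[ f fx].

Definition in_H2 f fx fxx : Prop := in_H1 f fx /\ in_H1 fx fxx.

Definition H1sq f fx : \bar R := (L2sq f + L2sq fx)%E.

Definition H2sq f fx fxx : \bar R := (L2sq f + L2sq fx + L2sq fxx)%E.

End SpaceNorms.

Section ClosedLoop.
Variable R : realType.
Variables mu nu wd c0 c1 : R.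

(* The feedback laws: w_x(0,t) = feedback0 (w(0,t)), w_x(1,t) = feedback1 (w(1,t)). *)
Definition feedback0 (y : R) : R :=
  1 / nu * ((c0 + 1 + wd) * y + 2 / (9 * c0) * y ^+ 3).

Definition feedback1 (y : R) : R :=
  - (1 / nu * ((c1 + 1 + wd) * y + 2 / (9 * c1) * y ^+ 3)).

(* Functions of time and space are written u t x.  The arguments wx, wt, wxt
   stand for the weak derivatives w_x, w_t, w_xt, and [w t], [wt t] are the
   continuous representatives, so that the traces at x = 0, 1 are plain values.

   The boundary conditions are of Neumann type, hence natural: the variational
   equation is the one obtained by multiplying the equation by v, integrating
   - mu w_xxt - nu w_xx by parts and replacing w_x(i,t) by its feedback law and
   w_xt(i,t) by the time derivative of that law. *)
Record weak_solution (w0 : R -> R) (w wx wt wxt : R -> R -> R) : Prop :=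
  WeakSolution {
  ws_initial : {in `[0, 1], w 0 =1 w0};
  ws_trace : forall t, 0 <= t -> {within `[0, 1], continuous (w t)};
  ws_H1 : forall t, 0 < t -> in_H1 (w t) (wx t);
  (* w is continuous from [0, +oo[ to L^2(0,1) *)
  ws_continuous : forall t, 0 <= t ->
    L2sq (fun x => w s x - w t x) @[s --> within (`[0, +oo[ : set R) (nbhs t)]
      --> (0 : \bar R)%E;
  (* w_t is the derivative of w : ]0, +oo[ -> L^2(0,1) in the sense of
     vector-valued distributions *)
  ws_time_derivative : forall v, in_L2 v ->
    weak_derivative `]0, +oo[ (fun t => L2ip (w t) v) (fun t => L2ip (wt t) v);
  ws_wt_trace : {ae lebesgue_measure, forall t : R, 0 < t ->
    {within `[0, 1], continuous (wt t)}};
  ws_wt_H1 : {ae lebesgue_measure, forall t : R, 0 < t -> in_H1 (wt t) (wxt t)};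
  ws_equation : {ae lebesgue_measure, forall t : R, 0 < t ->
    forall v vx, in_H1 v vx -> {within `[0, 1], continuous v} ->
      L2ip (wt t) v + mu * L2ip (wxt t) vx + nu * L2ip (wx t) vx
      + (1 + wd) * L2ip (wx t) v + L2ip (fun x => w t x * wx t x) v
      = (mu * (derive1 feedback1 (w t 1) * wt t 1) + nu * feedback1 (w t 1)) * v 1
      - (mu * (derive1 feedback0 (w t 0) * wt t 0) + nu * feedback0 (w t 0)) * v 0}
  }.

Definition jointly_measurable (u : R -> R -> R) : Prop :=
  measurable_fun (`]0, +oo[ `*` `[0, 1] : set (R * R)) (fun p => u p.1 p.2).

(* The regularity and a priori bound that the well-posedness theory provides.
   Joint measurability is the Bochner measurability of the classes; it is asked
   on the closed interval [0, 1] so that the traces are measurable in time. *)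
Record standing_regularity (w wx wxx wt wxt wxxt : R -> R -> R) : Prop :=
  StandingRegularity {
  sr_measurable : [/\ jointly_measurable w, jointly_measurable wx &
                      jointly_measurable wxx];
  sr_measurable_t : [/\ jointly_measurable wt, jointly_measurable wxt &
                        jointly_measurable wxxt];
  sr_H2 : forall t, 0 < t -> in_H2 (w t) (wx t) (wxx t);
  sr_wt_H2 : {ae lebesgue_measure, forall t : R, 0 < t ->
    in_H2 (wt t) (wxt t) (wxxt t)};
  sr_bound : exists K : R, {ae lebesgue_measure, forall t : R, 0 < t ->
    (H2sq (w t) (wx t) (wxx t) + L2sq (wt t) + mu%:E * L2sq (wxt t)
     + \int[lebesgue_measure]_(s in `[0%R, t])
         (H1sq (wt s) (wxt s) + mu%:E * L2sq (wxxt s))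
     <= K%:E)%E}
  }.

Definition E1 (w : R -> R -> R) (t : R) : R :=
  ((c0 + 1 + wd) + 1 / (3 * c0) * w t 0 ^+ 2) * w t 0 ^+ 2
  + ((c1 + 1 + wd) + 1 / (3 * c1) * w t 1 ^+ 2) * w t 1 ^+ 2.

Definition E3 (w wt : R -> R -> R) (t : R) : R :=
  ((1 + c0 + wd) + 2 / (3 * c0) * w t 0 ^+ 2) * wt t 0 ^+ 2
  + ((1 + c1 + wd) + 2 / (3 * c1) * w t 1 ^+ 2) * wt t 1 ^+ 2.

Definition decay_rate_bound : R :=
  1 / 2 * Num.min (nu / (mu + 1))
         (Num.min (nu / (2 * mu + nu))
         (Num.min (nu * (1 + c0 + wd) / (nu + (1 + c0 + wd) * mu))
                  (nu * (1 + c1 + wd) / (nu + (1 + c1 + wd) * mu)))).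

End ClosedLoop.

(* Main.v *)
Require Import Defs.
From HB Require Import structures.
From mathcomp Require Import all_boot all_order all_algebra.
From mathcomp Require Import all_classical all_reals all_analysis.
From mathcomp Require Import measurable_realfun.
From mathcomp Require Import ring lra.
Import Order.TTheory GRing.Theory Num.Theory.
Import numFieldNormedType.Exports.
Local Open Scope classical_set_scope.
Local Open Scope ring_scope.

(* Testing the equation with w, w_t and w_xx gives differential
   inequalities for
     V1 = ||w||^2 + mu ||w_x||^2 + (mu / nu) E_1,
     V2 = nu ||w_x||^2 + boundary terms  and  V3 = mu ||w_xx||^2.
   The first one, together with a Poincare inequality, yields
     V1' + 2 alpha V1 <= - delta (||w_x||^2 + E_1)
   with delta > 0 even for the extremal alpha, and bounds w uniformly in time.
   A combination V = P V1 + Q V2 + V3 then satisfies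
     V' + 2 alpha V <= - (1 / L) (||w_xt||^2 + mu ||w_xxt||^2 + (2 / nu) E_3),
   and multiplying by exp (2 alpha t) and integrating gives the estimate.
   The time derivatives exist only weakly.  The identity
     u (t) = u (0) + \int_0^t u_t,
   tested against L^2(0, 1), is carried from w to w_x and w_xx by Fubini and the
   fundamental lemma of the calculus of variations, and the energy identity
   ||u||^2' = 2 (u, u_t) follows from it by telescoping over fine partitions. *)

Set Implicit Arguments.
Unset Strict Implicit.
Unset Printing Implicit Defensive.

(** * Integrals over intervals and absolutely continuous functions *)

Section IntervalIntegral.
Context {R : realType}.
Implicit Types (f g h : R -> R) (s t r c : R).
Notation leb := (@lebesgue_measure R).

(** A differential inequality here always means an almost everywhere bound on the density of an
    absolutely continuous function; only its integral is exploited. The margin at the extremal rate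
    comes from the weights 3/4 and 9/8 of the Poincare inequality. The boundary weight 3/4 < 1 keeps
    a quarter of the boundary damping in reserve, and 9/8 is affordable because V1 dissipates 2 nu
    ||w_x||^2. Without a margin nothing could be added to V1: the estimates for V2 and V3 leave
    multiples of ||w_x||^2 over, and 2 alpha V adds boundary terms, all to be paid for by a large
    multiple of V1. Those multiples involve sup |w|^2 through the term w w_x. The uniform bound on w
    therefore has to come first, so that P, Q and the final constant do not depend on t. The
    boundary terms raise a separate difficulty: a trace is not an L^2(0, 1) pairing with w alone, so
    the weak identity in time says nothing about it directly. Integration by parts in x turns it
    into a pairing of (w, w_x) with fixed functions, and both components are absolutely continuous
    in time. *)

Lemma aeS (P Q : R -> Prop) : (forall x, P x -> Q x) ->
  {ae leb, forall x, P x} -> {ae leb, forall x, Q x}.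
Proof.
by move=> PQ; apply: filterS => //; exact: (ae_filter_ringOfSetsType leb).
Qed.

Lemma aeI (P Q : R -> Prop) : {ae leb, forall x, P x} ->
  {ae leb, forall x, Q x} -> {ae leb, forall x, P x /\ Q x}.
Proof.
by move=> aP aQ; apply: filterI => //; exact: (ae_filter_ringOfSetsType leb).
Qed.

Lemma ae_neq (a : R) : {ae leb, forall x, x != a}.
Proof.
exists [set a]; split => //; first exact: lebesgue_measure_set1.
by move=> x /= /negP; rewrite negbK => /eqP.
Qed.

Lemma ae_itv_oc (a b : R) (P : R -> Prop) : {ae leb, forall x, a < x < b -> P x} ->
  {ae leb, forall x, a < x <= b -> P x}.
Proof.
move=> /(aeI (ae_neq b)); apply: aeS => x [xb Px] /andP[ax xleb].
by apply: Px; rewrite ax lt_neqAle xb.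
Qed.

(** Half-open intervals make []s, t]] the exact disjoint union of []s, r]] and []r, t]], so that
    additivity holds without discarding null sets. *)
Definition itg s t f : Prop := leb.-integrable `]s, t] (EFin \o f).
Definition pint s t f : R := Rintegral leb `]s, t] f.

Lemma itg_sub s t s' t' f : s <= s' -> t' <= t -> itg s t f -> itg s' t' f.
Proof.
move=> ss tt; apply: integrableS => //.
by apply: subset_itv; rewrite bnd_simp.
Qed.

Lemma itgD s t f g : itg s t f -> itg s t g -> itg s t (fun x => f x + g x).
Proof.
by move=> If Ig; apply: (eq_integrable (mu := leb) _ ((EFin \o f) \+ (EFin \o g))%E) => //;
  exact: integrableD.
Qed.

Lemma itgZ s t c f : itg s t f -> itg s t (fun x => c * f x).
Proof.
by move=> If; apply: (eq_integrable (mu := leb) _ (fun x => c%:E * (EFin \o f) x)%E) => //;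
  exact: integrableZl.
Qed.

Lemma itgN s t f : itg s t f -> itg s t (fun x => - f x).
Proof.
by move=> /(@itgZ _ _ (-1)); apply: (eq_integrable (mu := leb) _ _) => // x _; rewrite /= mulN1r.
Qed.

Lemma itgB s t f g : itg s t f -> itg s t g -> itg s t (fun x => f x - g x).
Proof. by move=> If Ig; apply: itgD => //; apply: itgN. Qed.

Lemma itg_norm s t f : itg s t f -> itg s t (fun x => `|f x|).
Proof. by move=> /integrable_norm. Qed.

Lemma itg_eq s t f g : (forall x, s < x <= t -> f x = g x) -> itg s t f -> itg s t g.
Proof.
move=> fg; apply: eq_integrable => // x.
by rewrite inE /= in_itv /= => /fg ->.
Qed.

Lemma leb_oc_fin s t : (leb `]s, t] < +oo)%E.
Proof.
by rewrite lebesgue_measure_itv /=; case: ifP => _; rewrite ?ltry// -EFinB ltry.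
Qed.

Lemma leb_oc s t : s <= t -> leb `]s, t] = (t - s)%:E.
Proof.
move=> st; rewrite lebesgue_measure_itv /= lte_fin.
by case: ltgtP st => // ->; rewrite subrr.
Qed.

Lemma itg_cst s t c : itg s t (fun=> c).
Proof.
have fin := leb_oc_fin s t.
have bnd : [bounded (fun=> c) x | x in `]s, t]%classic].
  by exists `|c|; split; [exact: num_real|move=> x cx y _; exact: ltW].
exact: (measurable_bounded_integrable _ fin _ bnd).
Qed.

Lemma itg_meas s t f : itg s t f -> measurable_fun `]s, t] f.
Proof. by move=> /(measurable_int leb)/measurable_EFinP. Qed.

Lemma itg_le s t f g : measurable_fun `]s, t] f -> itg s t g ->
  (forall x, s < x <= t -> `|f x| <= g x) -> itg s t f.
Proof.
move=> mf Ig fg; apply: (le_integrable _ _ _ Ig) => //; first exact/measurable_EFinP.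
move=> x; rewrite /= in_itv /= => /fg xfg; rewrite lee_fin (le_trans xfg)//.
exact: ler_norm.
Qed.

Lemma itg_bounded s t f c : measurable_fun `]s, t] f ->
  (forall x, s < x <= t -> `|f x| <= c) -> itg s t f.
Proof. by move=> mf fc; exact: (itg_le mf (itg_cst s t c)). Qed.

Lemma itgM_bounded s t f g c : measurable_fun `]s, t] f -> itg s t g ->
  (forall x, s < x <= t -> `|f x| <= c) -> itg s t (fun x => f x * g x).
Proof.
move=> mf Ig fc; apply: (@itg_le _ _ _ (fun x => c * `|g x|)).
- by apply: measurable_funM => //; exact: itg_meas.
- exact/itgZ/itg_norm.
- by move=> x /fc xc; rewrite normrM ler_wpM2r.
Qed.

Lemma pint_eq s t f g : (forall x, s < x <= t -> f x = g x) ->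
  pint s t f = pint s t g.
Proof.
move=> fg; apply: eq_Rintegral => x; rewrite inE /= in_itv /=; exact: fg.
Qed.

Lemma pintD s t f g : itg s t f -> itg s t g ->
  pint s t (fun x => f x + g x) = pint s t f + pint s t g.
Proof. exact: RintegralD. Qed.

Lemma pintZ s t c f : itg s t f -> pint s t (fun x => c * f x) = c * pint s t f.
Proof. exact: RintegralZl. Qed.

Lemma pintB s t f g : itg s t f -> itg s t g ->
  pint s t (fun x => f x - g x) = pint s t f - pint s t g.
Proof. exact: RintegralB. Qed.

Lemma pintN s t f : itg s t f -> pint s t (fun x => - f x) = - pint s t f.
Proof.
move=> If; rewrite (@pint_eq _ _ _ (fun x => -1 * f x)) ?pintZ ?mulN1r//.
by move=> x _; rewrite mulN1r.
Qed.

Lemma pint_cst s t c : s <= t -> pint s t (fun=> c) = c * (t - s).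
Proof.
move=> st; rewrite /pint Rintegral_cst//; congr (_ * _).
by rewrite -[RHS]/(fine (t - s)%:E) -leb_oc.
Qed.

Lemma pint_same s f : pint s s f = 0.
Proof.
by rewrite /pint set_itv_ge ?Rintegral_set0// bnd_simp -leNgt.
Qed.

Lemma pint_cat r s t f : s <= r -> r <= t -> itg s t f ->
  pint s t f = pint s r f + pint r t f.
Proof.
move=> sr rt If.
have E : `]s, t]%classic = `]s, r]%classic `|` `]r, t]%classic.
  by apply: (@itv_bndbnd_setU _ _ (BRight s) (BRight r) (BRight t)); rewrite bnd_simp.
rewrite /pint E Rintegral_setU//; first by rewrite -E.
apply/disj_setPS => y [/=]; rewrite 2!in_itv/= => /andP[_ yx] /andP[].
by rewrite ltNge yx.
Qed.

Lemma pint_le s t f g : itg s t f -> itg s t g ->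
  (forall x, s < x <= t -> f x <= g x) -> pint s t f <= pint s t g.
Proof.
move=> If Ig fg; apply: le_Rintegral => // x /=; rewrite in_itv /=; exact: fg.
Qed.

Lemma pint_ge0 s t f : (forall x, s < x <= t -> 0 <= f x) -> 0 <= pint s t f.
Proof.
move=> f0; apply: Rintegral_ge0 => x /=; rewrite in_itv /=; exact: f0.
Qed.

Lemma pint_norm s t f : itg s t f -> `|pint s t f| <= pint s t (fun x => `|f x|).
Proof. exact: le_normr_Rintegral. Qed.

Lemma pint_ae_eq s t f g : measurable_fun `]s, t] f -> measurable_fun `]s, t] g ->
  {ae leb, forall x, s < x <= t -> f x = g x} -> pint s t f = pint s t g.
Proof.
move=> mf mg fg; congr fine; apply: ae_eq_integral => //.
- exact/measurable_EFinP.
- exact/measurable_EFinP.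
- apply: aeS fg => x fgx /=; rewrite in_itv /= => xst.
  by rewrite fgx.
Qed.

Lemma itg_ae s t f g : measurable_fun `]s, t] f -> itg s t g ->
  {ae leb, forall x, s < x <= t -> `|f x| <= g x} -> itg s t f.
Proof.
move=> mf Ig fg; apply/integrableP; split; first exact/measurable_EFinP.
have /integrableP[_] := itg_norm Ig; apply: le_lt_trans.
apply: ae_ge0_le_integral => //.
- exact/measurableT_comp/measurable_EFinP.
- by apply: measurableT_comp => //; apply/measurable_EFinP;
    apply: measurableT_comp => //; exact: itg_meas.
- apply: aeS fg => x fgx /=; rewrite in_itv /= => /fgx h.
  by rewrite lee_fin normr_id (le_trans h)// ler_norm.
Qed.

Lemma pint_ae_le s t f g : itg s t f -> itg s t g ->
  {ae leb, forall x, s < x <= t -> f x <= g x} -> pint s t f <= pint s t g.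
Proof.
move=> If Ig fg.
have mf := itg_meas If; have mg := itg_meas Ig.
(* [h] dominates [f] everywhere and equals [g] almost everywhere, which splits the claim into a
   pointwise comparison and an a.e. equality. *)
pose h x := Num.max (f x) (g x).
have mh : measurable_fun `]s, t] h by exact: measurable_maxr.
have hg : {ae leb, forall x, s < x <= t -> h x = g x}.
  by apply: aeS fg => x fgx /fgx; rewrite /h => /max_idPr.
rewrite -(pint_ae_eq mh mg hg); apply: pint_le => //.
  apply: (itg_ae mh (itg_norm Ig)).
  by apply: aeS hg => x hgx /hgx ->.
by move=> x _; rewrite le_max lexx.
Qed.

Lemma itg_ae_eq s t f g : measurable_fun `]s, t] f -> itg s t g ->
  {ae leb, forall x, s < x <= t -> f x = g x} -> itg s t f.
Proof.
move=> mf Ig fg; apply: (itg_ae mf (itg_norm Ig)).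
by apply: aeS fg => x fgx /fgx ->.
Qed.

End IntervalIntegral.

Section Primitives.
Context {R : realType}.
Implicit Types (f g h F G : R -> R) (s t r c T : R).
Notation leb := (@lebesgue_measure R).

(* [F] is absolutely continuous on [0, T] and [f] is its derivative. *)
Definition prim T F f : Prop := itg 0 T f /\
  forall s t, 0 <= s -> s <= t -> t <= T -> F t - F s = pint s t f.

(* Summing the local errors over a partition of mesh below [d] bounds the total
   error by [e] times a fixed integral, for every [e]. *)
Lemma prim_telescope T F f m : itg 0 T f -> itg 0 T m ->
  (forall e, 0 < e -> exists2 d, 0 < d & forall s t, 0 <= s -> s <= t -> t <= T ->
    t - s < d -> `|F t - F s - pint s t f| <= e * pint s t m) ->
  prim T F f.
Proof.
move=> If Im H; split => // s0 t0 s00 st0 t0T; apply/eqP; rewrite -subr_eq0 -normr_le0.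
have step e : 0 < e -> `|F t0 - F s0 - pint s0 t0 f| <= e * pint s0 t0 m.
  move=> /H[d d0 {}H].
  (* Induction on the number of cells, cutting off the last one. Cells have length at most [d / 2]
     because the local estimate requires a length strictly below [d]. *)
  have claim (k : nat) s t : 0 <= s -> s <= t -> t <= T -> t - s <= k%:R * (d / 2) ->
      `|F t - F s - pint s t f| <= e * pint s t m.
    elim: k s t => [|k IH] s t s_ge0 st tT.
      rewrite mul0r subr_le0 => ts; have -> : t = s by apply/eqP; rewrite eq_le ts.
      by rewrite !pint_same !subrr normr0 mulr0.
    rewrite -natr1 mulrDl mul1r => tsk.
    pose r := Num.max s (t - d / 2).
    have sr : s <= r by rewrite le_max lexx.
    have rt : r <= t by rewrite ge_max st/= gerBl divr_ge0// ltW.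
    have rd : t - d / 2 <= r by rewrite le_max lexx orbT.
    have rk : r - s <= k%:R * (d / 2).
      rewrite lerBlDr ge_max; apply/andP; split; last lra.
      by rewrite lerDr mulr_ge0// divr_ge0// ltW.
    have I1 : itg s t f by exact: itg_sub If.
    have I2 : itg s t m by exact: itg_sub Im.
    rewrite (pint_cat sr rt I1) (pint_cat sr rt I2).
    have h1 := IH s r s_ge0 sr (le_trans rt tT) rk.
    have h2 : `|F t - F r - pint r t f| <= e * pint r t m.
      by apply: H => //; [exact: le_trans sr|lra].
    rewrite mulrDr; apply: le_trans (lerD h1 h2).
    rewrite [leLHS](_ : _ = `|(F r - F s - pint s r f) + (F t - F r - pint r t f)|).
      exact: ler_normD.
    by congr `|_|; ring.
  have [k hk] : exists k : nat, t0 - s0 <= k%:R * (d / 2).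
    have d2 : 0 < d / 2 by rewrite divr_gt0.
    exists (Num.truncn ((t0 - s0) / (d / 2))).+1.
    rewrite -ler_pdivrMr// ltW// truncnS_gt//.
  exact: claim hk.
have M0 : 0 <= pint s0 t0 m.
  by have := step 1 ltr01; rewrite mul1r; apply: le_trans.
rewrite leNgt; apply/negP => E0.
set E := `|_| in step E0.
(* This choice makes the right-hand side at most [E / 2], which contradicts [0 < E]; the summand 1
   keeps the denominator positive when the integral of [m] vanishes. *)
have := step (E / (2 * (pint s0 t0 m + 1))).
rewrite divr_gt0// => [/(_ isT)|]; last by rewrite mulr_gt0// ltr_wpDl.
rewrite -mulrA => h.
have : (2 * (pint s0 t0 m + 1))^-1 * pint s0 t0 m <= 2^-1.
  rewrite mulrC ler_pdivrMr ?mulr_gt0 ?ltr_wpDl//; lra.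
move=> /(ler_wpM2l (ltW E0)); lra.
Qed.

Lemma itg_abs_cont T f e : itg 0 T f -> 0 < e ->
  exists2 d, 0 < d & forall s t, 0 <= s -> s <= t -> t <= T -> t - s < d ->
    pint s t (fun x => `|f x|) < e.
Proof.
move=> If e0.
have : leb.-integrable setT (EFin \o f \_ `]0, T]).
  by rewrite -restrict_EFin; apply/integrable_restrict => //=; rewrite setTI.
move=> /integral_normr_continuous /(_ e e0)[d [d0 hd]].
exists d => // s t s0 st tT tsd.
have : (leb `]s, t] < d%:E)%E.
  rewrite lebesgue_measure_itv /=; case: ifP => _; last by rewrite lte_fin.
  by rewrite -EFinB lte_fin.
move=> /hd-/(_ (measurable_itv _)); apply: le_lt_trans.
rewrite [leLHS](_ : _ = \int[leb]_(x in `]s, t]) `|(f \_ `]0, T]) x|)//.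
apply: eq_Rintegral => x; rewrite inE /= in_itv /= => /andP[sx xt].
rewrite patchE mem_set//= in_itv /=.
by rewrite (le_lt_trans s0 sx) (le_trans xt tT).
Qed.

Lemma prim_dist T F f s t : prim T F f -> 0 <= s -> s <= t -> t <= T ->
  `|F t - F s| <= pint s t (fun x => `|f x|).
Proof.
move=> [If hF] s0 st tT; rewrite hF//; apply: pint_norm.
exact: itg_sub If.
Qed.

Lemma prim_bounded T F f : prim T F f -> exists2 c, 0 <= c &
  forall x, 0 <= x -> x <= T -> `|F x| <= c.
Proof.
move=> HF; exists (`|F 0| + `|pint 0 T (fun x => `|f x|)|); first by rewrite addr_ge0.
move=> x x0 xT; have := prim_dist HF (lexx 0) x0 xT.
have Ia : itg 0 T (fun x => `|f x|) by apply: itg_norm; case: HF.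
rewrite (pint_cat x0 xT Ia).
have : 0 <= pint x T (fun x => `|f x|) by apply: pint_ge0.
move=> h1 h2.
have -> : F x = F 0 + (F x - F 0) by rewrite addrC subrK.
rewrite (le_trans (ler_normD _ _))// lerD2l (le_trans h2)//.
by rewrite (le_trans _ (ler_norm _))// lerDl.
Qed.

(** Retraction of the line onto [0, T]. Composing with it extends a function on [0, T] by its end
    values, so that continuity on the segment becomes plain continuity on the whole line. *)
Definition clamp T x : R := Num.max 0 (Num.min T x).

Lemma clamp_itv T x : 0 <= T -> 0 <= clamp T x <= T.
Proof. by move=> T0; rewrite /clamp le_max lexx/= ge_max T0 ge_min lexx. Qed.

Lemma clampE T x : 0 <= x -> x <= T -> clamp T x = x.
Proof. by move=> x0 xT; rewrite /clamp (min_idPr xT) (max_idPr x0). Qed.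

Lemma clamp_continuous T : continuous (clamp T).
Proof.
move=> x; apply: continuous_max; first exact: cst_continuous.
by apply: continuous_min; [exact: cst_continuous|exact: id].
Qed.

Lemma clamp_dist T x y : 0 <= T -> x <= y -> 0 <= clamp T y - clamp T x <= y - x.
Proof.
move=> T0 xy; rewrite /clamp /Order.max /Order.min.
by case: (ltP T x) => ?; case: (ltP T y) => ?; do ?case: ltP => ?;
  apply/andP; split; lra.
Qed.

Lemma prim_continuous T F f : 0 <= T -> prim T F f -> continuous (F \o clamp T).
Proof.
move=> T0 HF x; have [If _] := HF.
apply/cvgrPdist_lt => e e0; have [d d0 hd] := itg_abs_cont If e0.
near=> y.
have xy : `|x - y| < d by near: y; exact: cvgr_dist_lt.
have key u v : u <= v -> `|u - v| < d -> `|F (clamp T v) - F (clamp T u)| < e.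
  move=> uv uvd; have /andP[h1 h2] := clamp_dist T0 uv.
  have /andP[u0 uT] := clamp_itv u T0; have /andP[v0 vT] := clamp_itv v T0.
  apply: le_lt_trans (prim_dist HF u0 _ vT) _; first by rewrite -subr_ge0.
  apply: hd => //; first by rewrite -subr_ge0.
  by apply: le_lt_trans h2 _; move: uvd; rewrite distrC ger0_norm// subr_ge0.
have [xley|/ltW ylex] := leP x y; last by apply: key => //; rewrite distrC.
by rewrite /= distrC; apply: key.
Unshelve. all: by end_near. Qed.

Lemma prim_measurable T F f : 0 <= T -> prim T F f -> measurable_fun `]0, T] F.
Proof.
move=> T0 HF.
apply: (eq_measurable_fun (F \o clamp T)).
  by move=> x; rewrite inE /= in_itv /= => /andP[/ltW x0 xT]; rewrite clampE.
apply: measurable_funTS; apply: continuous_measurable_fun.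
exact: prim_continuous HF.
Qed.

Lemma prim_itgM T F f g : 0 <= T -> prim T F f -> itg 0 T g ->
  itg 0 T (fun x => F x * g x).
Proof.
move=> T0 HF Ig; have [c c0 hc] := prim_bounded HF.
apply: (@itgM_bounded _ _ _ _ _ c) => //; first exact: prim_measurable HF.
by move=> x /andP[/ltW x0 xT]; exact: hc.
Qed.

Lemma primM T F f G g : 0 <= T -> prim T F f -> prim T G g ->
  prim T (fun x => F x * G x) (fun x => f x * G x + F x * g x).
Proof.
move=> T0 HF HG; have [If hF] := HF; have [Ig hG] := HG.
have IfG : itg 0 T (fun x => f x * G x).
  by apply: itg_eq (prim_itgM T0 HG If) => x _; rewrite mulrC.
have IFg : itg 0 T (fun x => F x * g x) by exact: (prim_itgM T0 HF Ig).
have Ifn := itg_norm If; have Ign := itg_norm Ig.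
apply: (@prim_telescope _ _ _ (fun x => `|f x| + `|g x|)).
- exact: itgD.
- exact: itgD.
move=> e e0.
have [d d0 hd] := itg_abs_cont If e0.
have [d' d'0 hd'] := itg_abs_cont Ig e0.
exists (Num.min d d'); first by rewrite lt_min d0.
move=> s t s0 st tT; rewrite lt_min => /andP[std std'].
have S h : itg 0 T h -> itg s t h by exact: itg_sub.
have IfGt : itg s t (fun r => f r * G t).
  by apply: (@itg_eq _ _ _ (fun r => G t * f r)); [move=> *; rewrite mulrC|exact/itgZ/S].
have IFgs : itg s t (fun r => F s * g r) by exact/itgZ/S.
(* Freezing [G] at [t] and [F] at [s] makes the product rule exact; the error against the true
   density is then the oscillation of [F] and [G] over a short interval, at most [e]. *)
have E : F t * G t - F s * G s = pint s t (fun r => f r * G t + F s * g r).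
  rewrite pintD// pintZ; last exact: S.
  rewrite (@pint_eq _ _ _ (fun r => f r * G t) (fun r => G t * f r)); last by move=> *; rewrite mulrC.
  rewrite pintZ; last exact: S.
  by rewrite -hF// -hG//; ring.
have ID : itg s t (fun r => f r * G t + F s * g r) by exact: itgD.
have ID' : itg s t (fun r => f r * G r + F r * g r) by apply: S; exact: itgD.
rewrite E -pintB//; apply: (le_trans (pint_norm (itgB ID ID'))).
have IR : itg s t (fun r => `|f r| + `|g r|) by apply: itgD; exact: S.
rewrite -pintZ//; apply: pint_le; [exact/itg_norm/itgB|exact: itgZ|].
move=> r /andP[sr rt].
have r0 : 0 <= r by rewrite (le_trans s0)// ltW.
have h1 : `|G t - G r| <= e.
  apply: le_trans (prim_dist HG r0 rt tT) _; apply: ltW; apply: hd' => //; lra.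
have h2 : `|F s - F r| <= e.
  rewrite distrC; apply: le_trans (prim_dist HF s0 (ltW sr) (le_trans rt tT)) _.
  apply: ltW; apply: hd => //; [exact: ltW|exact: le_trans tT|lra].
rewrite [X in `|X|](_ : _ = f r * (G t - G r) + (F s - F r) * g r); last ring.
rewrite (le_trans (ler_normD _ _))// !normrM mulrDr lerD//.
  by rewrite mulrC ler_wpM2r.
by rewrite ler_wpM2r.
Qed.

Lemma primD T F f G g : prim T F f -> prim T G g ->
  prim T (fun x => F x + G x) (fun x => f x + g x).
Proof.
move=> [If hF] [Ig hG]; split=> [|s t s0 st tT]; first exact: itgD.
rewrite pintD; [|exact: itg_sub If|exact: itg_sub Ig].
by rewrite -hF// -hG//; ring.
Qed.

Lemma primZ T c F f : prim T F f -> prim T (fun x => c * F x) (fun x => c * f x).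
Proof.
move=> [If hF]; split=> [|s t s0 st tT]; first exact: itgZ.
by rewrite pintZ; [rewrite -hF//; ring|exact: itg_sub If].
Qed.

Lemma prim_cst T c : prim T (fun=> c) (fun=> 0).
Proof.
split=> [|s t s0 st tT]; first exact: itg_cst.
by rewrite pint_cst// mul0r subrr.
Qed.

Lemma prim_id T : prim T (fun x => x) (fun=> 1).
Proof.
split=> [|s t s0 st tT]; first exact: itg_cst.
by rewrite pint_cst// mul1r.
Qed.

Lemma prim_eq T F f G g : prim T F f ->
  (forall x, 0 <= x -> x <= T -> F x = G x) ->
  (forall x, 0 < x <= T -> f x = g x) -> prim T G g.
Proof.
move=> [If hF] FG fg; split=> [|s t s0 st tT]; first exact: itg_eq If.
rewrite -!FG//; [|exact: (le_trans st tT)|exact: (le_trans s0 st)].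
rewrite hF//; apply: pint_eq => x /andP[sx xt]; apply: fg.
by rewrite (le_lt_trans s0 sx) (le_trans xt tT).
Qed.

Lemma prim_ae_eq T F f G g : prim T F f ->
  (forall x, 0 <= x -> x <= T -> F x = G x) ->
  measurable_fun `]0, T] g -> {ae leb, forall x, 0 < x <= T -> g x = f x} ->
  prim T G g.
Proof.
move=> [If hF] FG mg gf; have Ig := itg_ae_eq mg If gf; split=> // s t s0 st tT.
rewrite -!FG//; [|exact: (le_trans st tT)|exact: (le_trans s0 st)].
rewrite hF//; apply: pint_ae_eq.
- by apply: itg_meas; exact: itg_sub If.
- by apply: itg_meas; exact: itg_sub Ig.
apply: aeS gf => x gfx /andP[sx xt]; rewrite gfx//.
by rewrite (le_lt_trans s0 sx) (le_trans xt tT).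
Qed.

Lemma prim_pint T f : itg 0 T f -> prim T (fun x => pint 0 x f) f.
Proof.
move=> If; split=> // s t s0 st tT.
rewrite (pint_cat s0 st); first by rewrite addrC addKr.
exact: itg_sub If.
Qed.


End Primitives.

(** * The du Bois-Reymond lemma *)

Section DuBoisReymond.
Context {R : realType}.
Implicit Types (f g h F G : R -> R) (s t r c T : R).
Notation leb := (@lebesgue_measure R).

Lemma continuous_clamp T f : 0 <= T -> {within `[0, T], continuous f} ->
  continuous (f \o clamp T).
Proof.
move=> T0 /subspace_continuousP cf x.
have hx : `[0, T]%classic (clamp T x) by rewrite /= in_itv /=; exact: clamp_itv.
have cc : clamp T y @[y --> x] --> clamp T x := @clamp_continuous R T x.
apply: cvg_comp (cf _ hx) => U wU; have [e /= e0 he] := cc _ wU.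
exists e => //= z /he /=; apply; rewrite in_itv /=; exact: clamp_itv.
Qed.

Lemma itg_continuous s t f : continuous f -> itg s t f.
Proof.
move=> cf; have : leb.-integrable `[s, t] (EFin \o f).
  apply: continuous_compact_integrable; first exact: segment_compact.
  exact: continuous_subspaceT.
by apply: integrableS => //; apply: subset_itvr; rewrite bnd_simp.
Qed.

Lemma pint_oo T h : measurable_fun `]0, T] h ->
  Rintegral leb `]0, T[ h = pint 0 T h.
Proof.
move=> mh; rewrite /pint /Rintegral integral_itv_bndo_bndc//.
apply/measurable_EFinP; apply: measurable_funS mh => //.
by apply: subset_itvl; rewrite bnd_simp.
Qed.

Lemma itg_oo T h : leb.-integrable `]0, T[ (EFin \o h) -> itg 0 T h.
Proof.
move=> /integrableP[mh Ih]; apply/integrableP; split.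
  by apply/measurable_EFinP/measurable_fun_itv_bndo_bndcP/measurable_EFinP.
rewrite -integral_itv_bndo_bndc//; exact: measurableT_comp.
Qed.

Lemma prim_C1 T f : (forall x, derivable f x 1) -> continuous (derive1 f) ->
  prim T f (derive1 f).
Proof.
move=> df cf'; split=> [|s t s0 st tT]; first exact: itg_continuous.
move: st; rewrite le_eqVlt => /predU1P[->|st]; first by rewrite subrr pint_same.
have cf x : {for x, continuous f}.
  by apply: differentiable_continuous; apply/derivable1_diffP.
have LR : derivable_oo_LRcontinuous f s t.
  split; first by move=> x _; exact: df.
  - by apply: cvg_at_right_filter; exact: cf.
  - by apply: cvg_at_left_filter; exact: cf.
have E := @continuous_FTC2 R (derive1 f) f s t st (continuous_subspaceT cf') LR
  (fun _ _ => erefl).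
rewrite /pint Rintegral_itv_obnd_cbnd; last exact: itg_continuous.
by rewrite /Rintegral E.
Qed.

Lemma pint_continuous_eq0 T f : 0 < T -> continuous f ->
  (forall x, 0 < x <= T -> 0 <= f x) -> pint 0 T f = 0 ->
  forall x, 0 < x < T -> f x = 0.
Proof.
move=> T0 cf f0 If0 x /andP[x0 xT]; apply/eqP; rewrite eq_le; apply/andP; split; last by rewrite f0 ?x0 ?ltW.
rewrite leNgt; apply/negP => fx.
have fx2 : 0 < f x / 2 by rewrite divr_gt0.
have /cvgrPdist_lt/(_ _ fx2) := cf x.
move=> /nbhs_ballP[d /= d0 hd].
pose e := Num.min d x / 2.
have e0 : 0 < e by rewrite divr_gt0// lt_min d0.
have ed : e < d by rewrite /e ltr_pdivrMr// gt_min; apply/orP; left; lra.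
have ex : e < x by rewrite /e ltr_pdivrMr// gt_min; apply/orP; right; lra.
have I s t : itg s t f by exact: itg_continuous.
have h1 : 0 <= pint 0 (x - e) f.
  by apply: pint_ge0 => y /andP[y0 yx]; apply: f0; rewrite y0/=; lra.
have h2 : 0 <= pint x T f.
  by apply: pint_ge0 => y /andP[y0 yx]; apply: f0; apply/andP; split; lra.
have h3 : pint (x - e) x (fun=> f x / 2) <= pint (x - e) x f.
  apply: pint_le => //; first exact: itg_cst.
  move=> y /andP[y1 y2]; have : ball x d y.
    by rewrite /ball /= ger0_norm; lra.
  by move=> /hd /=; rewrite ltr_norml => /andP[_]; lra.
rewrite pint_cst in h3; last lra.
have h4 : 0 < f x / 2 * (x - (x - e)) by rewrite mulr_gt0//; lra.
have := If0; rewrite (@pint_cat _ (x - e))//; [|lra|lra].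
rewrite (@pint_cat _ x (x - e))//; lra.
Qed.

(* The test function is the primitive of [(h - m) chi], where [chi] is a bump on
   [a, b] and [m] is the [chi]-weighted mean of [h]; testing against it gives
   [\int (h - m) ^+ 2 * chi = 0]. *)
Lemma dubois_const T h : 0 < T -> continuous h ->
  (forall phi, test_function `]0, T[ phi -> pint 0 T (fun x => h x * derive1 phi x) = 0) ->
  forall a b, 0 < a -> a < b -> b < T -> forall x y, a < x < b -> a < y < b -> h x = h y.
Proof.
move=> T0 ch H a b a0 ab bT.
pose chi x := Num.max 0 ((x - a) * (b - x)).
have chi0 x : 0 <= chi x by rewrite le_max lexx.
have cchi : continuous chi.
  move=> x; apply: (@continuous_max _ _ (fun=> 0) (fun x => (x - a) * (b - x))).
    exact: cst_continuous.
  apply: cvgM; first by apply: cvgB; [exact: cvg_id|exact: cvg_cst].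
  by apply: cvgB; [exact: cvg_cst|exact: cvg_id].
have chiab x : a < x < b -> 0 < chi x.
  by move=> /andP[ax xb]; rewrite lt_max mulr_gt0 ?orbT ?subr_gt0.
have chiN x : x <= a \/ b <= x -> chi x = 0.
  move=> xab; apply/eqP; rewrite eq_le chi0 andbT ge_max lexx/=.
  by case: xab => ?; [rewrite mulr_le0_ge0|rewrite mulr_ge0_le0]; lra.
have Ichi : pint 0 T chi != 0.
  apply/negP => /eqP E.
  have /chiab : a < (a + b) / 2 < b by apply/andP; split; lra.
  rewrite (pint_continuous_eq0 T0 cchi (fun x _ => chi0 x) E) ?ltxx//.
  by apply/andP; split; lra.
have chchi : continuous (fun x => h x * chi x).
  by move=> x; apply: cvgM; [exact: ch|exact: cchi].
pose m := pint 0 T (fun x => h x * chi x) / pint 0 T chi.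
pose psi x := (h x - m) * chi x.
have cpsi : continuous psi.
  move=> x; apply: cvgM; last exact: cchi.
  by apply: cvgB; [exact: ch|exact: cvg_cst].
have psi0 x : x <= a \/ b <= x -> psi x = 0 by move=> /chiN; rewrite /psi => ->; rewrite mulr0.
have Ipsi : pint 0 T psi = 0.
  rewrite (@pint_eq _ _ _ psi (fun x => h x * chi x - m * chi x)); last by move=> *; rewrite /psi mulrBl.
  rewrite pintB; [|exact: itg_continuous|exact/itgZ/itg_continuous].
  rewrite pintZ; last exact: itg_continuous.
  by rewrite /m mulfVK// subrr.
have IpsiT : leb.-integrable setT (EFin \o psi).
  have -> : EFin \o psi = (EFin \o psi) \_ `]0, T].
    apply/funext => x; rewrite patchE; case: ifPn => // /negP xT; rewrite /= psi0//.
    have [|ax] := leP x a; first by left.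
    right; rewrite leNgt; apply/negP => xb; apply: xT.
    by rewrite inE /= in_itv /= (lt_trans a0 ax)/= (le_trans (ltW xb))// ltW.
  have := @itg_continuous 0 T psi cpsi.
  by move/(integrable_mkcond (mu := leb)); apply.
(* Integrating from -oo makes [phi] differentiable at every real point. It vanishes left of [a]
   because [psi] does, and right of [b] because [psi] has mean zero; this is what the weighted mean
   [m] is for. *)
pose phi x := Rintegral leb `]-oo, x] psi.
have dphi x : derivable phi x 1 /\ derive1 phi x = psi x.
  apply: (@continuous_FTC1 _ psi -oo%O x (x + 1)).
  - by rewrite ltrDl.
  - by apply: integrableS IpsiT.
  - by rewrite ltNyr.
  - exact: cpsi.
have phi'E : derive1 phi = psi by apply/funext => x; case: (dphi x).
have phi0 x : x <= a \/ b <= x -> phi x = 0.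
  move=> [xa|bx].
    have E : {in `]-oo, x]%classic, psi =1 fun=> 0}.
      by move=> y; rewrite inE /= in_itv /= => yx; apply: psi0; left; exact: le_trans xa.
    transitivity (Rintegral leb `]-oo, x] (fun=> 0)); first by apply: eq_Rintegral; exact: E.
    by rewrite /Rintegral integral0.
  have E (y : R) : (psi \_ `]-oo, x]) y = (psi \_ `]0, T]) y.
    rewrite !patchE !mem_setE !in_itv /=.
    have [ya|ay] := leP y a; first by rewrite psi0 ?if_same//; left.
    have [yb|by'] := leP b y; first by rewrite psi0 ?if_same//; right.
    rewrite (lt_trans a0 ay) (le_trans (ltW by') bx).
    by rewrite (le_trans (ltW by') (ltW bT)).
  rewrite -Ipsi /phi /pint Rintegral_mkcond [RHS]Rintegral_mkcond.
  by apply: eq_Rintegral => y _; exact: E.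
have Tphi : test_function `]0, T[ phi.
  split; [by move=> x; case: (dphi x)|by rewrite phi'E|].
  exists `[a, b]%classic; split; first exact: segment_compact.
    by apply: subset_itv; rewrite bnd_simp.
  move=> x; rewrite /= in_itv /= => /negP; rewrite negb_and -!ltNge => /orP xab.
  by apply: phi0; case: xab => /ltW; [left|right].
have := H _ Tphi; rewrite phi'E => Hpsi.
have Q : pint 0 T (fun x => (h x - m) ^+ 2 * chi x) = 0.
  rewrite (@pint_eq _ _ _ _ (fun x => h x * psi x - m * psi x)); last first.
    by move=> x _; rewrite /psi; ring.
  rewrite pintB.
  - by rewrite Hpsi pintZ; [rewrite Ipsi mulr0 subrr|exact: itg_continuous].
  - by apply: itg_continuous => x; apply: cvgM; [exact: ch|exact: cpsi].
  - exact/itgZ/itg_continuous.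
have cQ : continuous (fun x => (h x - m) ^+ 2 * chi x).
  move=> x; apply: cvgM; last exact: cchi.
  by apply: (@cvgM _ _ _ _ (fun x => h x - m) (fun x => h x - m));
    apply: cvgB; [exact: ch|exact: cvg_cst|exact: ch|exact: cvg_cst].
have hm x : a < x < b -> h x = m.
  move=> xab; have [ax xb] := andP xab.
  have q0 y : 0 < y <= T -> 0 <= (h y - m) ^+ 2 * chi y by rewrite mulr_ge0// sqr_ge0.
  have := pint_continuous_eq0 T0 cQ q0 Q (x := x).
  rewrite (lt_trans a0 ax) (lt_trans xb bT) => /(_ isT)/eqP.
  by rewrite mulf_eq0 (gt_eqF (chiab _ xab)) orbF sqrf_eq0 subr_eq0 => /eqP.
by move=> x y /hm -> /hm ->.
Qed.

End DuBoisReymond.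

Section FundamentalLemma.
Context {R : realType}.
Implicit Types (f g h F G : R -> R) (s t r c T : R).
Notation leb := (@lebesgue_measure R).

Lemma test_function_out (I : set R) (phi : R -> R) x :
  test_function I phi -> ~ I x -> phi x = 0.
Proof. by move=> [_ _ [K [_ KI K0]]] xI; apply: K0 => /KI. Qed.

Lemma test_function_prim (I : set R) (phi : R -> R) T :
  test_function I phi -> prim T phi (derive1 phi).
Proof. by move=> [dphi cphi _]; exact: prim_C1. Qed.

Lemma test_function_continuous (I : set R) (phi : R -> R) :
  test_function I phi -> continuous phi.
Proof.
by move=> [dphi _ _] x; apply: differentiable_continuous; exact/derivable1_diffP.
Qed.

Lemma prim_test_function T F f (phi : R -> R) : 0 <= T -> prim T F f ->
  test_function `]0, T[ phi ->
  pint 0 T (fun x => F x * derive1 phi x) = - pint 0 T (fun x => f x * phi x).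
Proof.
move=> T0 HF Tphi; have Hphi := test_function_prim T Tphi.
have [_ /(_ 0 T (lexx _) T0 (lexx _))] := primM T0 HF Hphi.
have -> : phi 0 = 0 by apply: (test_function_out Tphi); rewrite /= in_itv /= ltxx.
have -> : phi T = 0 by apply: (test_function_out Tphi); rewrite /= in_itv /= ltxx andbF.
rewrite !mulr0 subrr pintD.
- by move=> /esym/eqP; rewrite addrC addr_eq0 => /eqP.
- apply: (@itg_eq _ _ _ (fun x => phi x * f x)); first by move=> x _; exact: mulrC.
  by apply: (prim_itgM T0 Hphi); case: HF.
- by apply: (prim_itgM T0 HF); case: Hphi.
Qed.

(** The difference of [f] and the primitive of [g] is orthogonal to all derivatives of test
    functions, hence constant. Continuity of [f] is what turns the a.e. conclusion into one valid at
    every point, endpoints included. *)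
Lemma du_bois_reymond T f g : 0 < T -> continuous (f \o clamp T) -> itg 0 T g ->
  (forall phi, test_function `]0, T[ phi ->
    pint 0 T (fun x => f x * derive1 phi x) = - pint 0 T (fun x => g x * phi x)) ->
  prim T f g.
Proof.
move=> T0 cf Ig H; have T0' := ltW T0.
pose G x := pint 0 x g.
have HG : prim T G g := prim_pint Ig.
have cG : continuous (G \o clamp T) := prim_continuous T0' HG.
pose h x := f (clamp T x) - G (clamp T x).
have ch : continuous h by move=> x; apply: cvgB; [exact: cf|exact: cG].
have Hh phi : test_function `]0, T[ phi -> pint 0 T (fun x => h x * derive1 phi x) = 0.
  move=> Tphi; have [_ cphi' _] := Tphi.
  have I1 : itg 0 T (fun x => f (clamp T x) * derive1 phi x).
    by apply: itg_continuous => x; apply: cvgM; [exact: cf|exact: cphi'].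
  have I2 : itg 0 T (fun x => G (clamp T x) * derive1 phi x).
    by apply: itg_continuous => x; apply: cvgM; [exact: cG|exact: cphi'].
  rewrite (@pint_eq _ _ _ _ (fun x => f (clamp T x) * derive1 phi x - G (clamp T x) * derive1 phi x)); last first.
    by move=> x _; rewrite -mulrBl.
  rewrite pintB//.
  rewrite (@pint_eq _ _ _ (fun x => f (clamp T x) * derive1 phi x) (fun x => f x * derive1 phi x)); last first.
    by move=> x /andP[/ltW x0 xT]; rewrite clampE.
  rewrite (@pint_eq _ _ _ (fun x => G (clamp T x) * derive1 phi x) (fun x => G x * derive1 phi x)); last first.
    by move=> x /andP[/ltW x0 xT]; rewrite clampE.
  by rewrite H// (prim_test_function T0' HG Tphi) subrr.
have hcst x y : 0 < x < T -> 0 < y < T -> h x = h y.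
  move=> /andP[x0 xT] /andP[y0 yT].
  apply: (dubois_const T0 ch Hh (a := Num.min x y / 2) (b := (Num.max x y + T) / 2)).
  - by rewrite divr_gt0// lt_min x0.
  - have : Num.min x y <= Num.max x y by rewrite ge_min le_max lexx.
    have : 0 < Num.min x y by rewrite lt_min x0.
    lra.
  - have : Num.max x y < T by rewrite gt_max xT. lra.
  - have : Num.min x y <= x by rewrite ge_min lexx.
    have : x <= Num.max x y by rewrite le_max lexx.
    by move=> ? ?; apply/andP; split; lra.
  - have : Num.min x y <= y by rewrite ge_min lexx orbT.
    have : y <= Num.max x y by rewrite le_max lexx orbT.
    by move=> ? ?; apply/andP; split; lra.
(* Constancy is known only in the open interval; continuity carries it to 0 and [T]. A value
   differing from the midpoint value would differ from a nearby interior value too, and the witness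
   [y] is moved inwards when [x] is an endpoint. *)
have hcl x : 0 <= x -> x <= T -> h x = h (T / 2).
  move=> x0 xT; apply/eqP; rewrite -subr_eq0 -normr_le0 leNgt; apply/negP => hx.
  have /cvgrPdist_lt/(_ _ hx)/nbhs_ballP[d /= d0 hd] := ch x.
  have [y [yT xy]] : exists y, 0 < y < T /\ `|x - y| < d.
    have [->|xn0] := eqVneq x 0.
      exists (Num.min d T / 2).
      have : Num.min d T <= d by rewrite ge_min lexx.
      have : Num.min d T <= T by rewrite ge_min lexx orbT.
      have : 0 < Num.min d T by rewrite lt_min d0.
      by move=> ? ? ?; split; [apply/andP; split; lra|rewrite ler0_norm; lra].
    have {}x0 : 0 < x by rewrite lt_def xn0.
    have [->|xnT] := eqVneq x T.
      exists (T - Num.min d T / 2).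
      have : Num.min d T <= d by rewrite ge_min lexx.
      have : Num.min d T <= T by rewrite ge_min lexx orbT.
      have : 0 < Num.min d T by rewrite lt_min d0.
      by move=> ? ? ?; split; [apply/andP; split; lra|rewrite ger0_norm; lra].
    by exists x; rewrite subrr normr0 x0 lt_neqAle xnT.
  have := hd y xy; rewrite (hcst y (T / 2)) ?ltxx//.
  by apply/andP; split; lra.
apply: (@prim_eq _ _ (fun x => G x + h (T / 2)) (fun x => g x + 0)).
- exact: primD HG (prim_cst _ _).
- by move=> x x0 xT; rewrite -(hcl x)// /h clampE//; ring.
- by move=> x _; rewrite addr0.
Qed.

(** Lebesgue differentiation: the primitive of [h], cut off outside []0, T]], has derivative [h] at
    almost every point, and it is locally constant inside the interval. *)
Lemma pint_eq0_ae T h : itg 0 T h -> (forall x, 0 < x -> x < T -> pint 0 x h = 0) ->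
  {ae leb, forall x, 0 < x < T -> h x = 0}.
Proof.
move=> Ih H.
pose k : R -> R := h \_ `]0, T].
have kE (y : R) : 0 < y <= T -> k y = h y.
  by move=> yT; rewrite /k patchE mem_set//= in_itv.
have Ik : leb.-integrable setT (EFin \o k).
  move: Ih; rewrite /itg => /(integrable_mkcond (mu := leb))-/(_ (measurable_itv _)).
  apply: eq_integrable => //; first by move=> y _; rewrite /k restrict_EFin.
have lk : locally_integrable setT k.
  by apply: open_integrable_locally => //; exact: openT.
have Iky (y : R) : leb.-integrable `]-oo, y] (EFin \o k) by apply: integrableS Ik.
have := @FTC1Ny R k Iky lk.
apply: aeS => x [dF F'] /andP[x0 xT].
rewrite -kE ?x0 ?ltW// -F' derive1E.
have E : \near x, \int[leb]_(t in `]-oo, x]) k t = 0.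
  near=> y.
  have y0 : 0 < y by near: y; exact: lt_nbhsr.
  have yT : y < T by near: y; exact: lt_nbhsl.
  rewrite -(H y y0 yT) /pint Rintegral_mkcond [RHS]Rintegral_mkcond.
  suff E (z : R) : (k \_ `]-oo, y]) z = (h \_ `]0, y]) z.
    by apply: eq_Rintegral => z _; exact: E.
  rewrite /k !patchE !mem_setE !in_itv /=.
  case: (leP z y) => zy /=; last by rewrite andbF.
  by rewrite andbT (le_trans zy (ltW yT)) andbT.
rewrite (near_eq_derive _ E) ?derive_cst//.
Unshelve. all: by end_near. Qed.

(** Reduced to the du Bois-Reymond lemma: the hypothesis says that the primitive of [h] has weak
    derivative 0, so this primitive is constant and Lebesgue differentiation applies. *)
Lemma fundamental_lemma T h : 0 < T -> itg 0 T h ->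
  (forall phi, test_function `]0, T[ phi -> pint 0 T (fun x => h x * phi x) = 0) ->
  {ae leb, forall x, 0 < x < T -> h x = 0}.
Proof.
move=> T0 Ih H; have T0' := ltW T0.
have HH := prim_pint Ih.
have [_ E] : prim T (fun x => pint 0 x h) (fun=> 0).
  apply: du_bois_reymond => //; [exact: prim_continuous HH|exact: itg_cst|].
  move=> phi Tphi; rewrite (prim_test_function T0' HH Tphi) H// oppr0.
  rewrite (@pint_eq _ _ _ (fun x => 0 * phi x) (fun=> 0)); last by move=> x _; exact: mul0r.
  by rewrite pint_cst// mul0r oppr0.
apply: pint_eq0_ae => // x x0 xT.
have := E 0 x (lexx _) (ltW x0) (ltW xT).
by rewrite pint_same subr0 pint_cst ?mul0r// ltW.
Qed.

End FundamentalLemma.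

(** * Square-integrable functions of space and time *)

Section FubiniReal.
Context d1 d2 (T1 : measurableType d1) (T2 : measurableType d2) (R : realType).
Variable m1 : {sigma_finite_measure set T1 -> \bar R}.
Variable m2 : {sigma_finite_measure set T2 -> \bar R}.
Variables (D1 : set T1) (D2 : set T2).
Hypotheses (mD1 : measurable D1) (mD2 : measurable D2).

Let mD12 : measurable (D1 `*` D2) := measurableX mD1 mD2.

Let restrictX (f : T1 * T2 -> \bar R) s : D1 s ->
  (\int[m2]_x (f \_ (D1 `*` D2)) (s, x) = \int[m2]_(x in D2) f (s, x))%E.
Proof.
move=> D1s; rewrite [RHS]integral_mkcond; apply: eq_integral => x _.
rewrite !patchE; congr (if _ then _ else _).
by apply/idP/idP; rewrite !inE /=; [case|].
Qed.

Let restrictX0 (f : T1 * T2 -> \bar R) s : ~ D1 s ->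
  (\int[m2]_x (f \_ (D1 `*` D2)) (s, x) = 0)%E.
Proof.
move=> D1s; apply: integral0_eq => x _; rewrite patchE; case: ifPn => //.
by rewrite inE /= => -[].
Qed.

Let restrictXE (f : T1 * T2 -> \bar R) :
  (fun s => \int[m2]_x (f \_ (D1 `*` D2)) (s, x))%E =
  (fun s => \int[m2]_(x in D2) f (s, x))%E \_ D1.
Proof.
apply/funext => s; rewrite patchE; case: ifPn => [|/negP]; rewrite inE => D1s.
  exact: restrictX.
exact: restrictX0.
Qed.

Let restrictYE (f : T1 * T2 -> \bar R) :
  (fun x => \int[m1]_s (f \_ (D1 `*` D2)) (s, x))%E =
  (fun x => \int[m1]_(s in D1) f (s, x))%E \_ D2.
Proof.
apply/funext => x; rewrite patchE; case: ifPn => [|/negP]; rewrite inE => D2x.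
  rewrite [RHS]integral_mkcond; apply: eq_integral => s _.
  rewrite !patchE; congr (if _ then _ else _).
  by apply/idP/idP; rewrite !inE /=; [case|].
by apply: integral0_eq => s _; rewrite patchE; case: ifPn => //; rewrite inE /= => -[].
Qed.

Lemma tonelli_measurable (f : T1 * T2 -> \bar R) :
  measurable_fun (D1 `*` D2) f -> (forall p, 0 <= f p)%E ->
  measurable_fun D1 (fun s => \int[m2]_(x in D2) f (s, x))%E.
Proof.
move=> mf f0; apply/(measurable_restrictT _ mD1); rewrite -restrictXE.
apply: (measurable_fun_fubini_tonelli_F (f \_ (D1 `*` D2))).
  exact/(measurable_restrictT _ mD12).
by apply: erestrict_ge0 => p _; exact: f0.
Qed.

Lemma tonelli_restrict (f : T1 * T2 -> \bar R) :
  measurable_fun (D1 `*` D2) f -> (forall p, 0 <= f p)%E ->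
  (\int[m1]_(s in D1) \int[m2]_(x in D2) f (s, x) < +oo)%E ->
  (m1 \x m2)%E.-integrable setT (f \_ (D1 `*` D2)).
Proof.
move=> mf f0 fin; apply/integrable12ltyP.
  exact/(measurable_restrictT _ mD12).
have E p : (`|(f \_ (D1 `*` D2)) p| = (f \_ (D1 `*` D2)) p)%E.
  by rewrite gee0_abs//; apply: erestrict_ge0 => q _; exact: f0.
under eq_integral do under eq_integral do rewrite E.
by rewrite restrictXE -integral_mkcond.
Qed.

Variable f : T1 * T2 -> R.
Hypothesis If : (m1 \x m2)%E.-integrable setT ((EFin \o f) \_ (D1 `*` D2)).

Lemma fubini_itg1 : m1.-integrable D1
  (EFin \o (fun s => Rintegral m2 D2 (fun x => f (s, x)))).
Proof.
have IF := integrable_fubini_F If.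
have IF1 : m1.-integrable D1 (fun s => \int[m2]_(x in D2) (f (s, x))%:E)%E.
  by apply/(integrable_mkcond _ mD1); rewrite -(restrictXE (EFin \o f)).
have mF := measurable_int _ IF1.
apply: le_integrable IF1; [by []| |].
  apply/measurable_EFinP.
  exact: (measurableT_comp (f := fine)).
(* [fine] sends an infinite inner integral to 0, so the real-valued section integral stays dominated
   even at exceptional points. *)
move=> s _ /=; rewrite /Rintegral.
by case: (\int[m2]_(_ in _) _)%E => [r| |] /=; rewrite ?normr0 ?lexx ?leey.
Qed.

Lemma fubini_eq1 : Rintegral m1 D1 (fun s => Rintegral m2 D2 (fun x => f (s, x))) =
  fine (\int[m1 \x m2]_z ((EFin \o f) \_ (D1 `*` D2)) z)%E.
Proof.
rewrite -integral12_prod_meas1//; rewrite /fubini_F (restrictXE (EFin \o f)) -integral_mkcond.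
have IF := integrable_fubini_F If.
have IF1 : m1.-integrable D1 (fun s => \int[m2]_(x in D2) (f (s, x))%:E)%E.
  by apply/(integrable_mkcond _ mD1); rewrite -(restrictXE (EFin \o f)).
congr fine; apply: ae_eq_integral => //.
- exact: measurable_int fubini_itg1.
- exact: measurable_int IF1.
have := integrable_ae mD1 IF1; apply: filterS.
move=> s /= hs D1s; rewrite /Rintegral fineK//; exact: hs.
Qed.

Let integrable_G : m2.-integrable setT (fubini_G m1 ((EFin \o f) \_ (D1 `*` D2))).
Proof.
have mf := measurable_int _ If.
apply/integrableP; split; first exact: measurable_fubini_G If.
apply: le_lt_trans ((integrable21ltyP _ _ mf).1 If); apply: ge0_le_integral => //.
- by apply: measurableT_comp => //; exact: measurable_fubini_G If.
- apply: (measurable_fun_fubini_tonelli_G (abse \o (EFin \o f) \_ (D1 `*` D2))).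
    exact: measurableT_comp.
  by move=> p; exact: abse_ge0.
- move=> x _; apply: le_abse_integral => //.
  exact: measurableT_comp.
Qed.

Lemma fubini_itg2 : m2.-integrable D2
  (EFin \o (fun x => Rintegral m1 D1 (fun s => f (s, x)))).
Proof.
have IF := integrable_G.
have IF1 : m2.-integrable D2 (fun x => \int[m1]_(s in D1) (f (s, x))%:E)%E.
  by apply/(integrable_mkcond _ mD2); rewrite -(restrictYE (EFin \o f)).
have mF := measurable_int _ IF1.
apply: le_integrable IF1; [by []| |].
  apply/measurable_EFinP.
  exact: (measurableT_comp (f := fine)).
move=> s _ /=; rewrite /Rintegral.
by case: (\int[m1]_(_ in _) _)%E => [r| |] /=; rewrite ?normr0 ?lexx ?leey.
Qed.

Lemma fubini_eq2 : Rintegral m2 D2 (fun x => Rintegral m1 D1 (fun s => f (s, x))) =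
  fine (\int[m1 \x m2]_z ((EFin \o f) \_ (D1 `*` D2)) z)%E.
Proof.
rewrite -integral21_prod_meas1//; rewrite /fubini_G (restrictYE (EFin \o f)) -integral_mkcond.
have IF := integrable_G.
have IF1 : m2.-integrable D2 (fun x => \int[m1]_(s in D1) (f (s, x))%:E)%E.
  by apply/(integrable_mkcond _ mD2); rewrite -(restrictYE (EFin \o f)).
congr fine; apply: ae_eq_integral => //.
- exact: measurable_int fubini_itg2.
- exact: measurable_int IF1.
have := integrable_ae mD2 IF1; apply: filterS.
move=> s /= hs D1s; rewrite /Rintegral fineK//; exact: hs.
Qed.

Lemma fubini_ae2 : {ae m2, forall x, D2 x -> m1.-integrable D1 (fun s => (f (s, x))%:E)}.
Proof.
have := ae_integrable2 If; apply: filterS => x Ix D2x.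
apply/(integrable_mkcond _ mD1); apply: eq_integrable Ix => // s _.
rewrite !patchE /=; congr (if _ then _ else _).
by apply/idP/idP; rewrite !inE /=; [case|].
Qed.

End FubiniReal.

Section L2Space.
Context {R : realType}.
Implicit Types (f g h : R -> R) (s t r c T : R).
Notation leb := (@lebesgue_measure R).

Lemma in_L2_meas f : in_L2 f -> measurable_fun (`]0, 1] : set R) f.
Proof. by move=> [mf _]; apply/measurable_fun_itv_bndo_bndcP. Qed.

(** Bridge between the open interval on which the norms are defined and the half-open one on which
    [pint] lives. *)
Lemma in_L2P f : in_L2 f <->
  measurable_fun (`]0, 1] : set R) f /\ itg 0 1 (fun x => f x ^+ 2).
Proof.
have E : measurable_fun (`]0, 1[ : set R) f ->
    L2sq f = (\int[leb]_(x in `]0%R, 1%R]) ((f x ^+ 2)%:E))%E.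
  move=> mf; rewrite /L2sq integral_itv_bndo_bndc//.
  by apply/measurable_EFinP; exact: measurable_funX.
have N : (\int[leb]_(x in `]0%R, 1%R]) `|((f x ^+ 2)%:E)|)%E =
    (\int[leb]_(x in `]0%R, 1%R]) ((f x ^+ 2)%:E))%E.
  by apply: eq_integral => x _; rewrite /= ger0_norm// sqr_ge0.
split=> [[mf f2]|[mf If]].
  have mf' := (measurable_fun_itv_bndo_bndcP _ _ _).1 mf.
  split=> //; apply/integrableP; split.
    by apply/measurable_EFinP; exact: measurable_funX.
  by rewrite N -E.
have mf' := (measurable_fun_itv_bndo_bndcP _ _ _).2 mf.
split=> //; rewrite E// -N; by case/integrableP : If.
Qed.

Lemma in_L2_itgM f g : in_L2 f -> in_L2 g -> itg 0 1 (fun x => f x * g x).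
Proof.
move=> /in_L2P[mf If] /in_L2P[mg Ig].
apply: (@itg_le _ _ _ _ (fun x => f x ^+ 2 + g x ^+ 2)); [|exact: itgD|].
  exact: measurable_funM.
move=> x _; rewrite normrM -(real_normK (num_real (f x))) -(real_normK (num_real (g x))).
have := sqr_ge0 (`|f x| - `|g x|); have := sqr_ge0 (`|f x| + `|g x|).
nra.
Qed.

Lemma L2ipE f g : measurable_fun (`]0, 1] : set R) f -> measurable_fun (`]0, 1] : set R) g ->
  L2ip f g = pint 0 1 (fun x => f x * g x).
Proof. by move=> mf mg; rewrite /L2ip pint_oo//; exact: measurable_funM. Qed.

Lemma L2sqE f : in_L2 f -> L2sq f = (L2ip f f)%:E.
Proof.
move=> Lf; have mf := in_L2_meas Lf; have [_ f2] := Lf.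
have E : (\int[leb]_(x in `]0%R, 1%R[) ((f x * f x)%:E))%E = L2sq f.
  by apply: eq_integral => x _; rewrite expr2.
rewrite /L2ip /Rintegral E fineK// ge0_fin_numE//.
by apply: integral_ge0 => x _; rewrite lee_fin sqr_ge0.
Qed.

Lemma in_L2D f g : in_L2 f -> in_L2 g -> in_L2 (fun x => f x + g x).
Proof.
move=> Lf Lg; apply/in_L2P.
have mf := in_L2_meas Lf; have mg := in_L2_meas Lg.
split; first exact: measurable_funD.
apply: (@itg_eq _ _ _ (fun x => f x * f x + 2 * (f x * g x) + g x * g x)).
  by move=> x _; ring.
by do 2?apply: itgD; rewrite ?(in_L2_itgM)//; first exact: in_L2_itgM;
  [apply: itgZ|]; exact: in_L2_itgM.
Qed.

Lemma in_L2Z c f : in_L2 f -> in_L2 (fun x => c * f x).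
Proof.
move=> Lf; apply/in_L2P; have mf := in_L2_meas Lf.
split; first by apply: measurable_funM.
apply: (@itg_eq _ _ _ (fun x => c ^+ 2 * (f x * f x))).
  by move=> x _; ring.
exact/itgZ/in_L2_itgM.
Qed.

Lemma in_L2_ext f g : in_L2 f -> f = g -> in_L2 g.
Proof. by move=> ? <-. Qed.

Lemma in_L2B f g : in_L2 f -> in_L2 g -> in_L2 (fun x => f x - g x).
Proof.
move=> Lf /(in_L2Z (-1)) Lg; apply: in_L2_ext (in_L2D Lf Lg) _.
by apply/funext => x; rewrite mulN1r.
Qed.

Lemma in_L2_bounded c f : measurable_fun (`]0, 1] : set R) f ->
  (forall x, 0 < x <= 1 -> `|f x| <= c) -> in_L2 f.
Proof.
move=> mf fc; apply/in_L2P; split => //.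
apply: (@itg_bounded _ _ _ _ (c ^+ 2)); first exact: measurable_funX.
move=> x /fc fxc; rewrite normrX lerXn2r// ?nnegrE//.
exact: le_trans fxc.
Qed.

Lemma in_L2M_bounded c f g : measurable_fun (`]0, 1] : set R) f ->
  (forall x, 0 < x <= 1 -> `|f x| <= c) -> in_L2 g -> in_L2 (fun x => f x * g x).
Proof.
move=> mf fc Lg; have mg := in_L2_meas Lg; apply/in_L2P; split.
  exact: measurable_funM.
apply: (@itg_eq _ _ _ (fun x => f x * (f x * (g x * g x)))); first by move=> x _; ring.
by do 2 apply: (@itgM_bounded _ _ _ _ _ c) => //; exact: in_L2_itgM.
Qed.

Lemma in_L2_cst c : in_L2 (fun=> c).
Proof. exact: (@in_L2_bounded `|c|). Qed.

Lemma in_L2_itg f : in_L2 f -> itg 0 1 f.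
Proof.
move=> Lf; apply: itg_eq (in_L2_itgM Lf (in_L2_cst 1)) => x _.
by rewrite mulr1.
Qed.

Lemma L2ipC f g : L2ip f g = L2ip g f.
Proof. by apply: eq_Rintegral => x _; rewrite mulrC. Qed.

Lemma L2ipDl f g h : in_L2 f -> in_L2 g -> in_L2 h ->
  L2ip (fun x => f x + g x) h = L2ip f h + L2ip g h.
Proof.
move=> Lf Lg Lh; have mf := in_L2_meas Lf; have mg := in_L2_meas Lg.
have mh := in_L2_meas Lh.
rewrite !L2ipE//; last exact: measurable_funD.
rewrite -pintD; [|exact: in_L2_itgM..].
by apply: pint_eq => x _; rewrite mulrDl.
Qed.

Lemma L2ipZl c f h : in_L2 f -> in_L2 h -> L2ip (fun x => c * f x) h = c * L2ip f h.
Proof.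
move=> Lf Lh; have mf := in_L2_meas Lf; have mh := in_L2_meas Lh.
rewrite !L2ipE//; last exact: measurable_funM.
rewrite -pintZ; last exact: in_L2_itgM.
by apply: pint_eq => x _; rewrite mulrA.
Qed.

Lemma L2ipBl f g h : in_L2 f -> in_L2 g -> in_L2 h ->
  L2ip (fun x => f x - g x) h = L2ip f h - L2ip g h.
Proof.
move=> Lf Lg Lh; rewrite -[- L2ip g h]mulN1r -L2ipZl// -L2ipDl//; last exact: in_L2Z.
by apply: eq_Rintegral => x _; rewrite mulN1r.
Qed.

Lemma L2ipDr f g h : in_L2 f -> in_L2 g -> in_L2 h ->
  L2ip h (fun x => f x + g x) = L2ip h f + L2ip h g.
Proof. by move=> *; rewrite L2ipC L2ipDl// ![L2ip h _]L2ipC. Qed.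

Lemma L2ipZr c f h : in_L2 f -> in_L2 h -> L2ip h (fun x => c * f x) = c * L2ip h f.
Proof. by move=> *; rewrite L2ipC L2ipZl// L2ipC. Qed.

Lemma L2ipBr f g h : in_L2 f -> in_L2 g -> in_L2 h ->
  L2ip h (fun x => f x - g x) = L2ip h f - L2ip h g.
Proof. by move=> *; rewrite L2ipC L2ipBl// ![L2ip h _]L2ipC. Qed.

Lemma L2ip_ge0 f : 0 <= L2ip f f.
Proof. by apply: Rintegral_ge0 => x _; rewrite -expr2 sqr_ge0. Qed.

(** Expand [||e f + g||^2] and [||e f - g||^2], both nonnegative, and divide by [e]. The free weight
    [e] lets each energy estimate decide which share of a dissipative term it spends. *)
Lemma L2ip_young e f g : 0 < e -> in_L2 f -> in_L2 g ->
  2 * `|L2ip f g| <= e * L2ip f f + e^-1 * L2ip g g.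
Proof.
move=> e0 Lf Lg.
have P (c : R) : 0 <= e ^+ 2 * L2ip f f + 2 * e * c * L2ip f g + c ^+ 2 * L2ip g g.
  have Le := in_L2Z e Lf; have Lc := in_L2Z c Lg.
  have := L2ip_ge0 (fun x => e * f x + c * g x).
  rewrite L2ipDl ?L2ipDr//; last exact: in_L2D.
  rewrite !L2ipZl// !L2ipZr// (L2ipC g f) => h; apply: le_trans h _; lra.
rewrite -(ler_pM2l e0) mulrDr (mulrA e (e^-1)) mulfV ?gt_eqF// mul1r.
have := P 1; have := P (-1).
by case: (ler0P (L2ip f g)) => _; lra.
Qed.

End L2Space.

Section SpaceTime.
Context {R : realType}.
Implicit Types (u v : R -> R -> R) (f g h : R -> R) (s t r c T : R).
Notation leb := (@lebesgue_measure R).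

(* The class of [u] in L^2(0, T; L^2(0, 1)). *)
Definition st_L2 T u : Prop :=
  [/\ jointly_measurable u, {ae leb, forall s, 0 < s <= T -> in_L2 (u s)} &
      (\int[leb]_(s in `]0%R, T]) L2sq (u s) < +oo)%E].

Let mX T : measurable (`]0, T] `*` `]0, 1[ : set (R * R)).
Proof. by apply: measurableX; exact: measurable_itv. Qed.

Let mXsub T : (`]0, T] `*` `]0, 1[ : set (R * R)) `<=` `]0, +oo[ `*` `[0, 1].
Proof.
move=> [s x] /=; rewrite !in_itv /= => -[/andP[-> _] /andP[/ltW -> /ltW ->]].
by [].
Qed.

Lemma jointly_measurableM u v : jointly_measurable u -> jointly_measurable v ->
  jointly_measurable (fun s x => u s x * v s x).
Proof. by move=> mu mv; exact: measurable_funM. Qed.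

Lemma jointly_measurable_time u x : 0 <= x <= 1 -> jointly_measurable u ->
  measurable_fun (`]0, +oo[ : set R) (fun s => u s x).
Proof.
move=> x01 mu.
apply: (measurable_comp _ _ mu (g := fun s => (s, x))).
- by apply: measurableX; exact: measurable_itv.
- by move=> _ [s /= s0 <-]; split => //=; rewrite in_itv.
- by apply: measurable_funTS; exact: pair2_measurable.
Qed.

Let square_int T u : st_L2 T u ->
  (leb \x leb)%E.-integrable setT
    ((fun p : R * R => (u p.1 p.2 ^+ 2)%:E) \_ (`]0, T] `*` `]0, 1[)).
Proof.
move=> [mu Lu fin].
apply: (tonelli_restrict _ _ (m1 := leb) (m2 := leb) (f := (fun p : R * R => (u p.1 p.2 ^+ 2)%:E))) => //.
- apply/measurable_EFinP; apply: measurable_funX.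
  by apply: measurable_funS (@mXsub T) mu; apply: measurableX; exact: measurable_itv.
- by move=> p; rewrite lee_fin sqr_ge0.
Qed.

Lemma L2sq_measurable T u : jointly_measurable u ->
  measurable_fun (`]0, T] : set R) (fun s => L2sq (u s)).
Proof.
move=> mu; have m1 := measurable_itv `]0, T]; have m2 := measurable_itv `]0 : R, 1[.
have sq0 (p : R * R) : (0 <= (u p.1 p.2 ^+ 2)%:E)%E by rewrite lee_fin sqr_ge0.
have msq : measurable_fun (`]0, T] `*` `]0, 1[ : set (R * R))
    (fun p : R * R => (u p.1 p.2 ^+ 2)%:E).
  apply/measurable_EFinP; apply: measurable_funX.
  by apply: measurable_funS (@mXsub T) mu; apply: measurableX; exact: measurable_itv.
exact: (@tonelli_measurable _ _ _ _ R leb _ _ m1 m2 _ msq sq0).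
Qed.

Lemma st_L2_sub S T u : S <= T -> st_L2 T u -> st_L2 S u.
Proof.
move=> ST [mu Lu fin]; split=> //.
  by apply: aeS Lu => s Lu /andP[s0 sS]; apply: Lu; rewrite s0 (le_trans sS ST).
apply: le_lt_trans fin; apply: ge0_subset_integral => //.
- exact: L2sq_measurable.
- by move=> s _; apply: integral_ge0 => x _; rewrite lee_fin sqr_ge0.
- by apply: subset_itvl; rewrite bnd_simp.
Qed.

Let product_int T u v : st_L2 T u -> st_L2 T v ->
  (leb \x leb)%E.-integrable setT
    ((EFin \o (fun p : R * R => u p.1 p.2 * v p.1 p.2)) \_ (`]0, T] `*` `]0, 1[)).
Proof.
move=> Hu Hv; have Iu := square_int Hu; have Iv := square_int Hv.
have [mu _ _] := Hu; have [mv _ _] := Hv.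
apply: le_integrable (integrableD _ Iu Iv) => //.
  apply/(measurable_restrictT _ (@mX T)); apply/measurable_EFinP.
  apply: measurable_funS (@mXsub T) (jointly_measurableM mu mv).
  by apply: measurableX; exact: measurable_itv.
move=> p _; rewrite /= !patchE; case: ifPn => _; last by rewrite abse0.
rewrite -EFinD /= lee_fin [leRHS]ger0_norm ?addr_ge0 ?sqr_ge0//.
rewrite normrM -(real_normK (num_real (u _ _))) -(real_normK (num_real (v _ _))).
have := sqr_ge0 (`|u p.1 p.2| - `|v p.1 p.2|).
have := sqr_ge0 (`|u p.1 p.2| + `|v p.1 p.2|).
nra.
Qed.

Lemma st_itg T u v : st_L2 T u -> st_L2 T v -> itg 0 T (fun s => L2ip (u s) (v s)).
Proof.
move=> Hu Hv; have := product_int Hu Hv.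
by move/(fubini_itg1 (m1 := leb) (m2 := leb)); apply.
Qed.

Lemma in_L2_jointly_measurable f : in_L2 f -> jointly_measurable (fun=> f).
Proof.
move=> [mf _].
have mf' : measurable_fun (`[0, 1] : set R) f by exact: measurable_fun_itv_cc mf.
apply: (measurable_comp _ _ mf' (g := snd)).
- exact: measurable_itv.
- by move=> _ [[s x] /= [_ ?] <-].
- by apply: measurable_funTS; exact: measurable_snd.
Qed.

Lemma st_L2_cst T f : in_L2 f -> st_L2 T (fun=> f).
Proof.
move=> Lf; split; first exact: in_L2_jointly_measurable.
  by apply: (aeS (P := fun=> True)) => //; exact: aeW.
rewrite L2sqE// integral_cst; last exact: measurable_itv.
apply: lte_mul_pinfty; [by rewrite lee_fin L2ip_ge0|by []|exact: leb_oc_fin].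
Qed.

Lemma st_fubini T u g : st_L2 T u -> in_L2 g ->
  [/\ itg 0 1 (fun x => pint 0 T (fun s => u s x)),
      itg 0 1 (fun x => pint 0 T (fun s => u s x) * g x) &
      pint 0 T (fun s => L2ip (u s) g) =
        pint 0 1 (fun x => pint 0 T (fun s => u s x) * g x)].
Proof.
move=> Hu Lv; have Hp := product_int Hu (st_L2_cst T Lv).
(* Pairing with the constant 1 gives integrability of [u] itself, since integrability on the product
   is available for products of two square-integrable functions. *)
have Hp1 := product_int Hu (st_L2_cst T (in_L2_cst 1)).
pose U x := pint 0 T (fun s => u s x).
pose W x := pint 0 T (fun s => u s x * g x).
have IU : itg 0 1 (fun x => pint 0 T (fun s => u s x * 1)).
  apply: itg_oo; move/(fubini_itg2 (m1 := leb) (m2 := leb)): Hp1; apply.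
  exact: measurable_itv.
have IW : itg 0 1 W.
  apply: itg_oo; move/(fubini_itg2 (m1 := leb) (m2 := leb)): Hp; apply.
  exact: measurable_itv.
have {}IU : itg 0 1 U.
  by apply: itg_eq IU => x _; apply: pint_eq => s _; rewrite mulr1.
have mUg : measurable_fun (`]0, 1] : set R) (fun x => U x * g x).
  by apply: measurable_funM; [exact: itg_meas|exact: in_L2_meas].
(* The factor [g x] can be pulled out of the time integral only where the section of [u] at [x] is
   integrable, that is for almost every [x]. *)
have UW : {ae leb, forall x, 0 < x <= 1 -> U x * g x = W x}.
  apply: ae_itv_oc.
  have : {ae leb, forall x, `]0, 1[%classic x -> itg 0 T (fun s => u s x * 1)}.
    move/(fubini_ae2 (m1 := leb) (m2 := leb)): Hp1; apply.
    exact: measurable_itv.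
  apply: aeS => x Ix x01; rewrite [RHS](@pint_eq _ _ _ _ (fun s => g x * u s x)).
    rewrite pintZ ?(mulrC (U x))//; apply: itg_eq (Ix _); last by rewrite /= in_itv.
    by move=> s _; rewrite mulr1.
  by move=> s _; rewrite mulrC.
split=> //; first exact: itg_ae_eq mUg IW UW.
rewrite (pint_ae_eq mUg (itg_meas IW) UW).
transitivity (Rintegral leb `]0, 1[ W); last by apply: pint_oo; exact: itg_meas.
have m1 := measurable_itv `]0, T]; have m2 := measurable_itv `]0 : R, 1[.
have E1 := fubini_eq1 (m1 := leb) (m2 := leb) m1 Hp.
have E2 := fubini_eq2 (m1 := leb) (m2 := leb) m2 Hp.
exact: etrans E1 (esym E2).
Qed.

End SpaceTime.

(** * Energy identities *)

Section Evolution.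
Context {R : realType}.
Implicit Types (u ut ux utx : R -> R -> R) (f g h v : R -> R) (s t r c T : R).
Notation leb := (@lebesgue_measure R).

(* [u] is absolutely continuous from [0, T] to L^2(0, 1), with derivative [ut],
   in the weak sense of testing against every element of L^2(0, 1). *)
Definition evol T u ut : Prop := forall v, in_L2 v ->
  prim T (fun t => L2ip (u t) v) (fun t => L2ip (ut t) v).

Lemma in_L2_continuous f : continuous f -> in_L2 f.
Proof.
move=> cf; apply/in_L2P; split; first by apply: itg_meas; exact: itg_continuous.
by apply: itg_continuous => x; apply: (@cvgM _ _ _ _ f f); exact: cf.
Qed.

Lemma weak_derivative_L2ip f g phi : weak_derivative `]0, 1[ f g ->
  test_function `]0, 1[ phi -> L2ip f (derive1 phi) = - L2ip g phi.
Proof. by move=> [_ _]; apply. Qed.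

Lemma evol_weak_derivative T u ut ux utx : 0 <= T -> evol T u ut ->
  (forall t, 0 <= t <= T -> in_H1 (u t) (ux t)) ->
  {ae leb, forall t, 0 < t <= T -> in_H1 (ut t) (utx t)} ->
  st_L2 T utx -> evol T ux utx.
Proof.
move=> T0 Hev HH1 Htx Hutx v Lv; split; first exact: st_itg (st_L2_cst T Lv).
have key t : 0 <= t -> t <= T ->
    L2ip (ux t) v - L2ip (ux 0) v = pint 0 t (fun s => L2ip (utx s) v).
  move=> t0 tT; have Hutx' := st_L2_sub tT Hutx.
  have [_ Lux _] : in_H1 (u t) (ux t) by apply: HH1; rewrite t0.
  have [_ Lux0 _] : in_H1 (u 0) (ux 0) by apply: HH1; rewrite lexx.
  have [_ _ wt] : in_H1 (u t) (ux t) by apply: HH1; rewrite t0.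
  have [_ _ w0] : in_H1 (u 0) (ux 0) by apply: HH1; rewrite lexx.
  pose U x := pint 0 t (fun s => utx s x).
  pose h x := (ux t x - ux 0 x) - U x.
  have Ld : in_L2 (fun x => ux t x - ux 0 x) by exact: in_L2B.
  have mux := in_L2_meas Lux; have mux0 := in_L2_meas Lux0.
  have hv g : in_L2 g -> itg 0 1 (fun x => U x * g x) ->
      pint 0 1 (fun x => h x * g x) = L2ip (ux t) g - L2ip (ux 0) g - pint 0 1 (fun x => U x * g x).
    move=> Lg IUg; rewrite -L2ipBl// L2ipE; [|exact: in_L2_meas..].
    rewrite -pintB//; last exact: in_L2_itgM.
    by apply: pint_eq => x _; rewrite /h mulrBl.
  have [IU _ _] := st_fubini Hutx' Lv.
  have Ih : itg 0 1 h by apply: itgB => //; exact: in_L2_itg.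
  have h0 : {ae leb, forall x, 0 < x < 1 -> h x = 0}.
    apply: fundamental_lemma => //.
    move=> phi Tphi.
    have Lphi : in_L2 phi by apply: in_L2_continuous; exact: test_function_continuous Tphi.
    have Lphi' : in_L2 (derive1 phi) by apply: in_L2_continuous; case: Tphi.
    have [_ IUphi Ephi] := st_fubini Hutx' Lphi.
    rewrite hv// -Ephi.
    have -> : L2ip (ux t) phi = - L2ip (u t) (derive1 phi).
      by rewrite (weak_derivative_L2ip wt Tphi) opprK.
    have -> : L2ip (ux 0) phi = - L2ip (u 0) (derive1 phi).
      by rewrite (weak_derivative_L2ip w0 Tphi) opprK.
    have [I' /(_ 0 t (lexx _) t0 tT) E'] := Hev _ Lphi'.
    have I'' : itg 0 t (fun s => L2ip (ut s) (derive1 phi)) by exact: itg_sub I'.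
    have -> : pint 0 t (fun s => L2ip (utx s) phi) = - pint 0 t (fun s => L2ip (ut s) (derive1 phi)).
      rewrite -pintN//; apply: pint_ae_eq.
      - by apply: itg_meas; exact: st_itg (st_L2_cst _ Lphi).
      - by apply: itg_meas; exact: itgN.
      - apply: aeS Htx => s hs /andP[s0 st]; have sT : 0 < s <= T by rewrite s0 (le_trans st tT).
        by have [_ _ ws] := hs sT; rewrite (weak_derivative_L2ip ws Tphi) opprK.
    by rewrite -E'; ring.
  have [_ IUv Ev] := st_fubini Hutx' Lv.
  have := hv v Lv IUv; rewrite -Ev.
  have -> : pint 0 1 (fun x => h x * v x) = pint 0 1 (fun=> 0).
    apply: pint_ae_eq => //.
      by apply: measurable_funM; [exact: itg_meas Ih|exact: in_L2_meas].
    by apply: ae_itv_oc; apply: aeS h0 => x hx /hx ->; rewrite mul0r.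
  rewrite pint_cst// mul0r => /esym/eqP; rewrite subr_eq0 => /eqP //.
move=> s t s0 st tT; have t0 := le_trans s0 st; have sT := le_trans st tT.
have : L2ip (ux t) v - L2ip (ux s) v = (L2ip (ux t) v - L2ip (ux 0) v) - (L2ip (ux s) v - L2ip (ux 0) v).
  by ring.
rewrite !key// (pint_cat s0 st) ?(addrC (pint 0 s _)) ?addrK//.
exact: st_itg (st_L2_sub tT Hutx) (st_L2_cst _ Lv).
Qed.

(** Square-root Hoelder continuity in time. For fixed [s] and [t] the increment [d] is itself an
    admissible test function; Young's inequality with weight [t - s] then produces half of
    [||d||^2], which is absorbed on the left. *)
Lemma evol_dist T u ut : evol T u ut -> st_L2 T ut ->
  (forall t, 0 <= t <= T -> in_L2 (u t)) ->
  forall s t, 0 <= s -> s <= t -> t <= T ->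
  L2ip (fun x => u t x - u s x) (fun x => u t x - u s x) <=
  (t - s) * pint s t (fun r => L2ip (ut r) (ut r)).
Proof.
move=> Hev Hut Lu s t s0; rewrite le_eqVlt => /predU1P[<- tT|st tT].
  rewrite subrr mul0r /L2ip; under eq_Rintegral do rewrite subrr mul0r.
  by rewrite /Rintegral integral0.
set d := fun x => _.
have Lt : in_L2 (u t) by apply: Lu; rewrite tT andbT; lra.
have Ls : in_L2 (u s) by apply: Lu; rewrite s0 /=; lra.
have Ld : in_L2 d by exact: in_L2B.
have [Id /(_ s t s0 (ltW st) tT)] := Hev _ Ld.
rewrite -L2ipBl// -/d => E.
have S f : itg 0 T f -> itg s t f by exact: itg_sub.
have Im : itg s t (fun r => L2ip (ut r) (ut r)) by apply: S; exact: st_itg.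
have ts : 0 < t - s by rewrite subr_gt0.
have : L2ip d d <= pint s t (fun r => 2^-1 * (t - s) * L2ip (ut r) (ut r) + 2^-1 * (t - s)^-1 * L2ip d d).
  rewrite {1}E; apply: pint_ae_le; first exact: S.
    by apply: itgD; [exact: itgZ|exact: itg_cst].
  have [_ Lut _] := Hut; apply: aeS Lut => r hr /andP[sr rt].
  have Lr : in_L2 (ut r) by apply: hr; apply/andP; split; lra.
  have := L2ip_young ts Lr Ld; have := ler_norm (L2ip (ut r) d); lra.
rewrite pintD; [|exact: itgZ|exact: itg_cst].
rewrite pintZ// pint_cst ?(ltW st)//.
have -> : 2^-1 * (t - s)^-1 * L2ip d d * (t - s) = 2^-1 * L2ip d d.
  by field; rewrite gt_eqF.
lra.
Qed.

(* On an interval of length h, Young's inequality and [evol_dist] bound the error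
   of the linearisation by 2 h \int ||ut||^2, so that [prim_telescope] applies. *)
Lemma evol_energy T u ut : evol T u ut -> st_L2 T u -> st_L2 T ut ->
  (forall t, 0 <= t <= T -> in_L2 (u t)) ->
  prim T (fun t => L2ip (u t) (u t)) (fun t => 2 * L2ip (u t) (ut t)).
Proof.
move=> Hev Hu Hut Lu.
have Im : itg 0 T (fun r => L2ip (ut r) (ut r)) by exact: st_itg.
have Iu : itg 0 T (fun t => 2 * L2ip (u t) (ut t)) by apply: itgZ; exact: st_itg.
apply: (@prim_telescope _ _ _ _ (fun r => L2ip (ut r) (ut r))) => // e e0.
exists (e / 2); first by rewrite divr_gt0.
move=> s t s0; rewrite le_eqVlt => /predU1P[<- tT _|st tT tse].
  by rewrite !pint_same !subrr normr0 mulr0.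
have S f : itg 0 T f -> itg s t f by exact: itg_sub.
set M := pint s t (fun r => L2ip (ut r) (ut r)).
have ts : 0 < t - s by rewrite subr_gt0.
have Lt : in_L2 (u t) by apply: Lu; rewrite tT andbT; lra.
have Ls : in_L2 (u s) by apply: Lu; rewrite s0 /=; lra.
(* The difference of squares factors as the pairing of [u t - u s] with [u t + u s], and the second
   factor is a fixed test function on []s, t]]. *)
pose d := fun x => u t x + u s x.
have Ld : in_L2 d by exact: in_L2D.
have [Id /(_ s t s0 (ltW st) tT)] := Hev _ Ld.
rewrite {1 2}/d !L2ipDr// (L2ipC (u s) (u t)) => E.
have {E} -> : L2ip (u t) (u t) - L2ip (u s) (u s) = pint s t (fun r => L2ip (ut r) d).
  by rewrite -E; ring.
have I1 := S _ Id; have I2 := S _ Iu; have I3 := S _ Im.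
rewrite -pintB//; apply: le_trans (pint_norm (itgB I1 I2)) _.
have M0 : 0 <= M by apply: pint_ge0 => r _; exact: L2ip_ge0.
have MM (p q : R) : s <= p -> p <= q -> q <= t ->
    (q - p) * pint p q (fun r => L2ip (ut r) (ut r)) <= (t - s) * M.
  move=> sp pq qt; apply: ler_pM; [lra|apply: pint_ge0 => r _; exact: L2ip_ge0|lra|].
  have I4 : itg p t (fun r => L2ip (ut r) (ut r)) by exact: itg_sub I3.
  rewrite /M (pint_cat sp (le_trans pq qt) I3) (pint_cat pq qt I4).
  have : 0 <= pint s p (fun r => L2ip (ut r) (ut r)) by apply: pint_ge0 => r _; exact: L2ip_ge0.
  have : 0 <= pint q t (fun r => L2ip (ut r) (ut r)) by apply: pint_ge0 => r _; exact: L2ip_ge0.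
  lra.
apply: (@le_trans _ _ (pint s t (fun r => (t - s) * L2ip (ut r) (ut r) + M))).
  apply: pint_ae_le; [exact/itg_norm/itgB|by apply: itgD; [exact: itgZ|exact: itg_cst]|].
  have [_ Lut _] := Hut; apply: aeS Lut => r hr /andP[sr rt].
  have Lr : in_L2 (ut r) by apply: hr; apply/andP; split; lra.
  have Lur : in_L2 (u r) by apply: Lu; apply/andP; split; lra.
  have La : in_L2 (fun x => u t x - u r x) by exact: in_L2B.
  have Lb : in_L2 (fun x => u r x - u s x) by exact: in_L2B.
  have ha := le_trans (evol_dist Hev Hut Lu (ltW (le_lt_trans s0 sr)) rt tT) (MM r t (ltW sr) rt (lexx t)).
  have hb := le_trans (evol_dist Hev Hut Lu s0 (ltW sr) (le_trans rt tT)) (MM s r (lexx s) (ltW sr) rt).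
  have ya := L2ip_young ts Lr La; have yb := L2ip_young ts Lr Lb.
  have inv (z : R) : z <= (t - s) * M -> (t - s)^-1 * z <= M.
    by move=> zM; rewrite mulrC ler_pdivrMr// mulrC.
  have := inv _ ha; have := inv _ hb.
  have -> : L2ip (ut r) d - 2 * L2ip (u r) (ut r) =
     L2ip (ut r) (fun x => u t x - u r x) - L2ip (ut r) (fun x => u r x - u s x).
    by rewrite /d L2ipDr// !L2ipBr// (L2ipC (u r)); ring.
  have := ler_normB (L2ip (ut r) (fun x => u t x - u r x)) (L2ip (ut r) (fun x => u r x - u s x)).
  lra.
rewrite pintD; [|exact: itgZ|exact: itg_cst].
rewrite pintZ// pint_cst ?(ltW st)// -/M.
have : (t - s) * M <= e / 2 * M by rewrite ler_wpM2r// ltW.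
lra.
Qed.


End Evolution.

(** * Sobolev functions on the unit interval *)

Section SpatialH1.
Context {R : realType}.
Implicit Types (f fx g h v : R -> R) (s t r c T : R).
Notation leb := (@lebesgue_measure R).

(** Selects the absolutely continuous representative: for a continuous [f] the integral identity
    holds up to the endpoints, so [f 0] and [f 1] are genuine traces. *)
Lemma H1_prim f fx : in_H1 f fx -> {within `[0, 1], continuous f} -> prim 1 f fx.
Proof.
move=> [Lf Lfx [_ _ w]] cf; apply: du_bois_reymond => //.
- exact: continuous_clamp.
- exact: in_L2_itg.
move=> phi Tphi; have mf := in_L2_meas Lf; have mfx := in_L2_meas Lfx.
have := w _ Tphi; rewrite !pint_oo//.
  apply: measurable_funM => //; apply: itg_meas; apply: itg_continuous.
  exact: test_function_continuous Tphi.
apply: measurable_funM => //; apply: itg_meas; apply: itg_continuous.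
by case: Tphi.
Qed.

Lemma prim_weak_derivative f fx : in_L2 f -> in_L2 fx -> prim 1 f fx ->
  weak_derivative `]0, 1[ f fx.
Proof.
move=> Lf Lfx Hf; have oc h : in_L2 h -> leb.-integrable `]0, 1[ (EFin \o h).
  by move=> /in_L2_itg; apply: integrableS => //; apply: subset_itvl; rewrite bnd_simp.
split.
- by apply: open_integrable_locally => //; exact: oc.
- by apply: open_integrable_locally => //; exact: oc.
move=> phi Tphi; have mf := in_L2_meas Lf; have mfx := in_L2_meas Lfx.
have E := prim_test_function (@ler01 R) Hf Tphi.
rewrite !pint_oo//.
  apply: measurable_funM => //; apply: itg_meas; apply: itg_continuous.
  exact: test_function_continuous Tphi.
apply: measurable_funM => //; apply: itg_meas; apply: itg_continuous.
by case: Tphi.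
Qed.

Lemma test_function_H1 (phi : R -> R) : test_function `]0, 1[ phi -> in_H1 phi (derive1 phi).
Proof.
move=> Tphi; have Lphi : in_L2 phi.
  by apply: in_L2_continuous; exact: test_function_continuous Tphi.
have Lphi' : in_L2 (derive1 phi) by apply: in_L2_continuous; case: Tphi.
by split => //; apply: prim_weak_derivative => //; exact: test_function_prim Tphi.
Qed.

Lemma prim_onem T : prim T (fun x : R => 1 - x) (fun=> -1).
Proof.
apply: prim_eq (primD (prim_cst T 1) (primZ (-1) (prim_id T))) _ _ => x *.
  by rewrite mulN1r.
by rewrite add0r mulr1.
Qed.

Lemma in_L2_id : in_L2 (fun x : R => x).
Proof. by apply: in_L2_continuous => x; exact: cvg_id. Qed.

Lemma in_L2_onem : in_L2 (fun x : R => 1 - x).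
Proof. by apply: in_L2B; [exact: in_L2_cst|exact: in_L2_id]. Qed.

Section H1Function.
Variables f fx : R -> R.
Hypotheses (Lf : in_L2 f) (Lfx : in_L2 fx) (Hf : prim 1 f fx).

Let mf := in_L2_meas Lf.
Let mfx := in_L2_meas Lfx.

(** Integration by parts against [1 - x], which is 1 at 0 and 0 at 1. The point is to express the
    trace through pairings of [f] and [fx] with fixed L^2 functions, the only quantities whose
    evolution in time is known. The weight [x] serves the other endpoint. *)
Lemma trace0E : f 0 = L2ip f (fun=> 1) - L2ip fx (fun x => 1 - x).
Proof.
have mx : measurable_fun (`]0, 1] : set R) (fun x : R => 1 - x).
  by apply: in_L2_meas; exact: in_L2_onem.
have [_ /(_ 0 1 (lexx _) ler01 (lexx _))] := primM ler01 Hf (prim_onem 1).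
rewrite subrr mulr0 subr0 mulr1 !L2ipE// => E.
rewrite pintD in E; first last.
- by apply: in_L2_itgM => //; exact: in_L2_cst.
- by apply: in_L2_itgM => //; exact: in_L2_onem.
have : pint 0 1 (fun x => f x * -1) = - pint 0 1 (fun x => f x * 1).
  rewrite -pintN; last by apply: in_L2_itgM => //; exact: in_L2_cst.
  by apply: pint_eq => x _; rewrite mulrN.
lra.
Qed.

Lemma trace1E : f 1 = L2ip f (fun=> 1) + L2ip fx (fun x => x).
Proof.
have mx : measurable_fun (`]0, 1] : set R) (fun x : R => x).
  by apply: in_L2_meas; exact: in_L2_id.
have [_ /(_ 0 1 (lexx _) ler01 (lexx _))] := primM ler01 Hf (prim_id 1).
rewrite mulr0 subr0 mulr1 !L2ipE// => ->; rewrite addrC pintD//.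
- by apply: in_L2_itgM => //; exact: in_L2_id.
- by apply: in_L2_itgM => //; exact: in_L2_cst.
Qed.

Lemma H1_bounded : exists2 c, 0 <= c & forall x, 0 < x <= 1 -> `|f x| <= c.
Proof.
have [c c0 hc] := prim_bounded Hf; exists c => // x /andP[/ltW x0 x1].
exact: hc.
Qed.

Lemma in_L2_MH1 g : in_L2 g -> in_L2 (fun x => f x * g x).
Proof. by move=> Lg; have [c _ hc] := H1_bounded; exact: in_L2M_bounded hc Lg. Qed.

Lemma L2ip_derive_sq : 2 * L2ip fx f = f 1 ^+ 2 - f 0 ^+ 2.
Proof.
have [_ /(_ 0 1 (lexx _) ler01 (lexx _))] := primM ler01 Hf Hf.
rewrite pintD; [|exact: in_L2_itgM..].
rewrite -!L2ipE// (L2ipC f fx) => E; rewrite !expr2 E; ring.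
Qed.

Lemma L2ip_derive_cube : 3 * L2ip (fun x => f x * fx x) f = f 1 ^+ 3 - f 0 ^+ 3.
Proof.
have [_ /(_ 0 1 (lexx _) ler01 (lexx _))] := primM ler01 (primM ler01 Hf Hf) Hf.
have Lffx : in_L2 (fun x => f x * fx x) by exact: in_L2_MH1.
have mffx := in_L2_meas Lffx.
rewrite (@pint_eq _ _ _ _ (fun x => 3 * (f x * fx x * f x))); last by move=> x _; ring.
rewrite pintZ; last exact: in_L2_itgM.
by rewrite -L2ipE// => <-; ring.
Qed.

(** The multiplier [x - 1/2] weighs both endpoints by 1/2 and satisfies [|2 p| <= 1] on the
    interval. Young's inequality with weight 3/2 costs a third of [||f||^2]; dividing by the
    remaining 2/3 turns 1/2 and 3/4 into 3/4 and 9/8. *)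
Lemma H1_poincare :
  L2ip f f <= 3 / 4 * (f 0 ^+ 2 + f 1 ^+ 2) + 9 / 8 * L2ip fx fx.
Proof.
pose p x := x - 2^-1 : R.
have Hp : prim 1 p (fun=> 1).
  apply: prim_eq (primD (prim_id 1) (prim_cst 1 (- 2^-1))) _ _ => x * //.
  by rewrite addr0.
have Lp : in_L2 p by apply: in_L2B; [exact: in_L2_id|exact: in_L2_cst].
have mp := in_L2_meas Lp.
have [_ /(_ 0 1 (lexx _) ler01 (lexx _))] := primM ler01 Hp (primM ler01 Hf Hf).
have Lpfx : in_L2 (fun x => 2 * p x * fx x).
  apply: (@in_L2M_bounded _ 1) => //; first exact: measurable_funM.
  move=> x /andP[x0 x1]; rewrite /p ler_norml; apply/andP; split; lra.
have mpfx := in_L2_meas Lpfx.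
rewrite (@pint_eq _ _ _ _ (fun x => f x * f x + 2 * p x * fx x * f x)); last by move=> x _; ring.
rewrite pintD; [|exact: in_L2_itgM..].
rewrite -!L2ipE// => E.
have e32 : (0 : R) < 3 / 2 by lra.
have := L2ip_young e32 Lpfx Lf.
have : L2ip (fun x => 2 * p x * fx x) (fun x => 2 * p x * fx x) <= L2ip fx fx.
  rewrite !L2ipE//; apply: pint_le; [exact: in_L2_itgM..|].
  move=> x /andP[x0 x1]; rewrite -!expr2 exprMn -[leRHS]mul1r ler_wpM2r ?sqr_ge0//.
  rewrite /p; nra.
have := ler_norm (- L2ip (fun x => 2 * p x * fx x) f); rewrite normrN.
move: E; rewrite /p !expr2 invf_div; lra.
Qed.

Lemma H1_sup x : 0 <= x -> x <= 1 -> f x ^+ 2 <= 2 * f 0 ^+ 2 + 2 * L2ip fx fx.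
Proof.
move=> x0 x1; have := prim_dist Hf (lexx 0) x0 x1.
have Ln : in_L2 (fun y => `|fx y|).
  apply/in_L2P; split; first exact: measurableT_comp.
  apply: itg_eq (in_L2_itgM Lfx Lfx) => y _; rewrite real_normK ?num_real//.
have In := in_L2_itg Ln.
set P := pint 0 x _ => hP.
have P0 : 0 <= P by apply: pint_ge0.
have PN : P ^+ 2 <= L2ip fx fx.
  move: P0; rewrite le_eqVlt => /predU1P[<-|P0]; first by rewrite expr0n /= L2ip_ge0.
  have P1 : P <= L2ip (fun y => `|fx y|) (fun=> 1).
    rewrite L2ipE//; last exact: in_L2_meas.
    rewrite (@pint_eq _ _ _ _ (fun y => `|fx y|)); last by move=> y _; rewrite mulr1.
    rewrite (pint_cat x0 x1 In) lerDl; exact: pint_ge0.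
  (* Cauchy-Schwarz obtained from Young's inequality with the optimal weight [P^-1]:
     [2 P <= P^-1 ||fx||^2 + P]. *)
  have Pi : 0 < P^-1 by rewrite invr_gt0.
  have := L2ip_young Pi Ln (in_L2_cst 1).
  have -> : L2ip (fun y => `|fx y|) (fun y => `|fx y|) = L2ip fx fx.
    by apply: eq_Rintegral => y _; rewrite -expr2 real_normK ?num_real.
  have -> : L2ip (fun=> 1) (fun=> 1) = 1 :> R.
    by rewrite L2ipE// pint_cst// subr0 !mulr1.
  rewrite invrK mulr1 => Y.
  have : P <= P^-1 * L2ip fx fx.
    by have := ler_norm (L2ip (fun y => `|fx y|) (fun=> 1)); lra.
  by rewrite mulrC ler_pdivlMr// expr2.
have : (f x - f 0) ^+ 2 <= P ^+ 2.
  by rewrite -[leLHS]real_normK ?num_real// lerXn2r// nnegrE.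
have := sqr_ge0 (f x - 2 * f 0); rewrite !expr2 in PN *; nra.
Qed.

End H1Function.

End SpatialH1.

(** * Time regularity of the solution *)

Section TimeRegularity.
Context {R : realType}.
Implicit Types (f g h v : R -> R) (s t r c T K : R).
Notation leb := (@lebesgue_measure R).

Lemma ae_exists (P : R -> Prop) (a b : R) : a < b -> {ae leb, forall x, P x} ->
  exists2 x, a < x <= b & P x.
Proof.
move=> ab aP; apply: contrapT => nP.
have : leb.-negligible `]a, b].
  apply: negligibleS aP => x /=; rewrite in_itv /= => xab Px; apply: nP.
  by exists x.
move=> /negligibleP -/(_ (measurable_itv _)) E.
have := etrans (esym (leb_oc (ltW ab))) E => /eqP.
by rewrite eqe subr_eq0 gt_eqF.
Qed.

Lemma test_function_derive_out T (phi : R -> R) x : test_function `]0, T[ phi ->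
  T < x -> derive1 phi x = 0.
Proof.
move=> Tphi Tx; rewrite derive1E.
have E : \near x, phi x = (fun=> 0) x.
  near=> y; apply: (test_function_out Tphi); rewrite /= in_itv /= => /andP[_].
  by apply/negP; rewrite -leNgt ltW//; near: y; exact: lt_nbhsr.
by rewrite (near_eq_derive _ E) derive_cst.
Unshelve. all: by end_near. Qed.

Lemma test_function_widen T (phi : R -> R) : test_function `]0, T[ phi ->
  test_function `]0, +oo[ phi.
Proof.
move=> [d1 c1 [K [cK KI K0]]]; split => //; exists K; split => //.
by move=> x /KI /=; rewrite !in_itv /= andbT => /andP[].
Qed.

Lemma Rintegral_halfline T g : (forall x, T < x -> g x = 0) ->
  Rintegral leb `]0, +oo[ g = pint 0 T g.
Proof.
move=> g0; rewrite /pint Rintegral_mkcond [RHS]Rintegral_mkcond.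
suff E (x : R) : (g \_ `]0, +oo[) x = (g \_ `]0, T]) x.
  by apply: eq_Rintegral => x _; exact: E.
rewrite !patchE !mem_setE !in_itv /= andbT.
by have [xT|/g0->] := leP x T; rewrite ?andbT//= if_same andbF.
Qed.

(** The distributional derivative determines [L2ip (w t) v] only up to an a.e. modification; strong
    continuity into L^2, including at t = 0, makes the identity hold at all times and start from the
    initial datum. *)
Lemma evol_time_derivative T (w wt : R -> R -> R) : 0 < T ->
  (forall t, 0 <= t -> in_L2 (w t)) -> st_L2 T wt ->
  (forall t, 0 <= t ->
    L2sq (fun x => w s x - w t x) @[s --> within (`[0, +oo[ : set R) (nbhs t)]
      --> (0 : \bar R)%E) ->
  (forall v, in_L2 v ->
    weak_derivative `]0, +oo[ (fun t => L2ip (w t) v) (fun t => L2ip (wt t) v)) ->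
  evol T w wt.
Proof.
move=> T0 Lw Hwt wc wd v Lv.
apply: du_bois_reymond => //; last first.
- move=> phi Tphi; have [_ _ /(_ _ (test_function_widen Tphi))] := wd v Lv.
  rewrite (@Rintegral_halfline T); last first.
    by move=> x Tx; rewrite (test_function_derive_out Tphi Tx) mulr0.
  rewrite (@Rintegral_halfline T)// => x Tx.
  rewrite (test_function_out Tphi) ?mulr0//= in_itv /=.
  by apply/negP; rewrite negb_and -!leNgt (ltW Tx) orbT.
- exact: st_itg (st_L2_cst _ Lv).
apply: continuous_clamp; first exact: ltW.
apply/subspace_continuousP => t; rewrite /= in_itv /= => /andP[t0 tT].
apply/cvgrPdist_lt => e e0.
(* Young's weight, chosen so that both [k ||w s - w t||^2] and [k^-1 ||v||^2] are at most [e]; the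
   summand 1 keeps it positive when [v] is null. *)
pose k := (L2ip v v + 1) / e.
have vv := L2ip_ge0 v.
have k0 : 0 < k by rewrite divr_gt0// ltr_wpDl.
have ek : 0 < e / k by rewrite divr_gt0.
have /fine_cvgP[_ /cvgrPdist_lt/(_ _ ek)[d /= d0 hd]] := wc t t0.
exists d => // s /hd /= H; rewrite in_itv /= => /andP[s0 sT].
have Ls := Lw s s0; have Lt := Lw t t0.
have Ld : in_L2 (fun x => w s x - w t x) by exact: in_L2B.
have {}H : L2ip (fun x => w s x - w t x) (fun x => w s x - w t x) < e / k.
  have := H; rewrite in_itv /= s0 L2sqE//= sub0r normrN => /(_ isT).
  by apply: le_lt_trans; exact: ler_norm.
rewrite distrC -L2ipBl//.
have := L2ip_young k0 Ld Lv.
have : k * L2ip (fun x => w s x - w t x) (fun x => w s x - w t x) < e.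
  by move: H; rewrite ltr_pdivlMr// mulrC.
have : k^-1 * L2ip v v <= e.
  rewrite /k invf_div mulrAC ler_pdivrMr ?ltr_wpDl// ler_wpM2l ?ltW//; lra.
lra.
Qed.

End TimeRegularity.

Section RegularityBounds.
Context {R : realType}.
Implicit Types (u : R -> R -> R) (s t r c T K : R).
Notation leb := (@lebesgue_measure R).

Lemma L2sq_ge0 (f : R -> R) : (0 <= L2sq f)%E.
Proof. by apply: integral_ge0 => x _; rewrite lee_fin sqr_ge0. Qed.

Lemma H1sq_ge0 (f fx : R -> R) : (0 <= H1sq f fx)%E.
Proof. by rewrite /H1sq; apply: adde_ge0; exact: L2sq_ge0. Qed.

Lemma H2sq_ge0 (f fx fxx : R -> R) : (0 <= H2sq f fx fxx)%E.
Proof. by rewrite /H2sq; apply: adde_ge0; [apply: adde_ge0|]; exact: L2sq_ge0. Qed.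

Lemma muL2sq_ge0 c (f : R -> R) : 0 < c -> (0 <= c%:E * L2sq f)%E.
Proof. by move=> c0; apply: mule_ge0; [rewrite lee_fin ltW|exact: L2sq_ge0]. Qed.

Lemma st_L2_bounded T K u : jointly_measurable u ->
  {ae leb, forall t, 0 < t -> in_L2 (u t)} ->
  {ae leb, forall t, 0 < t -> (L2sq (u t) <= K%:E)%E} -> st_L2 T u.
Proof.
move=> mu Lu uK; split => //.
  by apply: aeS Lu => s Lu /andP[s0 _]; exact: Lu.
apply: (@le_lt_trans _ _ (\int[leb]_(s in `]0%R, T]) (`|K|)%:E)%E).
  apply: ae_ge0_le_integral => //.
  - by move=> s _; exact: L2sq_ge0.
  - exact: L2sq_measurable.
  - apply: aeS uK => s hs /=; rewrite in_itv /= => /andP[/hs + _].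
    by move=> /le_trans; apply; rewrite lee_fin ler_norm.
rewrite integral_cst; last exact: measurable_itv.
by apply: lte_mul_pinfty; [rewrite lee_fin|by []|exact: leb_oc_fin].
Qed.

Lemma st_L2_dominated T t c K u (Phi : R -> \bar R) : T <= t -> 0 < c ->
  jointly_measurable u -> {ae leb, forall s, 0 < s -> in_L2 (u s)} ->
  measurable_fun (`]0, t] : set R) Phi ->
  (forall s, c%:E * L2sq (u s) <= Phi s)%E ->
  (\int[leb]_(s in `[0%R, t]) Phi s <= K%:E)%E -> st_L2 T u.
Proof.
move=> Tt c0 mu Lu mPhi uPhi PhiK; apply: (st_L2_sub Tt); split => //.
  by apply: aeS Lu => s Lu /andP[s0 _]; exact: Lu.
have mL := L2sq_measurable (T := t) mu.
have h : (c%:E * \int[leb]_(s in `]0%R, t]) L2sq (u s) <= K%:E)%E.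
  rewrite -ge0_integralZl_EFin//; last exact: ltW.
    apply: le_trans PhiK; rewrite -integral_itv_obnd_cbnd//.
    apply: ge0_le_integral => //.
    - by move=> s _; rewrite mule_ge0 ?L2sq_ge0// lee_fin ltW.
    - exact: measurable_funeM.
  by move=> s _; exact: L2sq_ge0.
rewrite ltNge leye_eq; apply/negP => /eqP E; move: h.
by rewrite E gt0_muley ?lte_fin// leNgt ltry.
Qed.

End RegularityBounds.

(** * Absolute continuity in time of the solution, its derivatives and its traces *)

Section CleanSolution.
Variables (R : realType) (mu nu wd c0 c1 : R).
Hypothesis hmu : 0 < mu.
Variables (w0 w0x w0xx : R -> R).
Hypothesis hw0 : in_H2 w0 w0x w0xx.
Variables (w wx wxx wt wxt wxxt : R -> R -> R).
Hypothesis hw : weak_solution mu nu wd c0 c1 w0 w wx wt wxt.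
Hypothesis hreg : standing_regularity mu w wx wxx wt wxt wxxt.
Notation leb := (@lebesgue_measure R).

Lemma in_H1_ae_L2 : [/\ {ae leb, forall t : R, 0 < t -> in_L2 (wt t)},
  {ae leb, forall t : R, 0 < t -> in_L2 (wxt t)} &
  {ae leb, forall t : R, 0 < t -> in_L2 (wxxt t)}].
Proof.
have := sr_wt_H2 hreg => H.
by split; apply: aeS H => t Ht /Ht[[]] => ? ? _ [].
Qed.

Lemma st_L2_time T : [/\ st_L2 T wt, st_L2 T wxt & st_L2 T wxxt].
Proof.
have [L1 L2 L3] := in_H1_ae_L2.
have [m1 m2 m3] := sr_measurable_t hreg.
have [K HK] := sr_bound hreg.
(* The a priori bound is available only at almost every time, so it is read off at some admissible
   [t] beyond [T]; the maximum with 1 makes that time positive. *)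
pose T' := Num.max T 1.
have T'0 : 0 < T' by rewrite lt_max ltr01 orbT.
have T'1 : T' < T' + 1 by rewrite ltrDl.
have [t /andP[Tt _] Ht] := ae_exists T'1 HK.
have TT : T <= t by rewrite (le_trans _ (ltW Tt))// le_max lexx.
have {Ht} := Ht (lt_trans T'0 Tt).
set Phi := fun s : R => (H1sq (wt s) (wxt s) + mu%:E * L2sq (wxxt s))%E.
have mPhi : measurable_fun (`]0, t] : set R) Phi.
  apply: emeasurable_funD; last by apply: measurable_funeM; exact: L2sq_measurable.
  by apply: emeasurable_funD; exact: L2sq_measurable.
have muL s : (0 <= mu%:E * L2sq (wxxt s))%E.
  exact: muL2sq_ge0.
have L0 := @L2sq_ge0 R.
move=> Ht; have {Ht} PhiK : (\int[leb]_(s in `[0%R, t]) Phi s <= K%:E)%E.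
  apply: le_trans Ht; apply: leeDr; apply: adde_ge0; last exact: muL2sq_ge0.
  by apply: adde_ge0; [exact: H2sq_ge0|exact: L0].
split.
- apply: (st_L2_dominated TT ltr01 m1 L1 mPhi _ PhiK) => s.
  by rewrite mul1e /Phi /H1sq -addeA leeDl//; exact: adde_ge0.
- apply: (st_L2_dominated TT ltr01 m2 L2 mPhi _ PhiK) => s.
  by rewrite mul1e /Phi /H1sq -addeA addeCA leeDl//; exact: adde_ge0.
- apply: (st_L2_dominated TT hmu m3 L3 mPhi _ PhiK) => s.
  by rewrite /Phi leeDr//; exact: adde_ge0.
Qed.

Lemma st_L2_space T : [/\ st_L2 T w, st_L2 T wx & st_L2 T wxx].
Proof.
have [m1 m2 m3] := sr_measurable hreg.
have [K HK] := sr_bound hreg.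
have L t : 0 < t -> [/\ in_L2 (w t), in_L2 (wx t) & in_L2 (wxx t)].
  by move=> /(sr_H2 hreg)[[? ? _] [_ ? _]].
have aeL u : (forall t, 0 < t -> in_L2 (u t)) -> {ae leb, forall t, 0 < t -> in_L2 (u t)}.
  by move=> Lu; apply: aeW => t; exact: Lu.
have L0 := @L2sq_ge0 R.
have HK' : {ae leb, forall t, 0 < t -> (H2sq (w t) (wx t) (wxx t) <= K%:E)%E}.
  apply: aeS HK => t Ht t0; apply: le_trans (Ht t0).
  have h1 := L0 (wt t); have h2 := muL2sq_ge0 (wxt t) hmu.
  have h3 : (0 <= \int[leb]_(s in `[0%R, t])
      (H1sq (wt s) (wxt s) + mu%:E * L2sq (wxxt s)))%E.
    by apply: integral_ge0 => s _; apply: adde_ge0; [exact: H1sq_ge0|exact: muL2sq_ge0].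
  apply: le_trans (leeDl _ h3); apply: le_trans (leeDl _ h2); exact: leeDl.
split; apply: (@st_L2_bounded _ _ K) => //.
- by apply: aeL => t /L[].
- apply: aeS HK' => t Ht /Ht; apply: le_trans; rewrite /H2sq -addeA leeDl//; exact: adde_ge0.
- by apply: aeL => t /L[].
- apply: aeS HK' => t Ht /Ht; apply: le_trans; rewrite /H2sq -addeA addeCA leeDl//; exact: adde_ge0.
- by apply: aeL => t /L[].
- by apply: aeS HK' => t Ht /Ht; apply: le_trans; rewrite /H2sq leeDr//; exact: adde_ge0.
Qed.

(* The data of [weak_solution] and [standing_regularity] say nothing of [wx] and
   [wxx] at t = 0; there the derivatives of the initial datum are used. *)
Definition extend0 (f0 : R -> R) (u : R -> R -> R) t := if t <= 0 then f0 else u t.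

Local Notation W := (extend0 w0 w).
Local Notation Wx := (extend0 w0x wx).
Local Notation Wxx := (extend0 w0xx wxx).

Lemma extend0_gt0 f0 u t : 0 < t -> extend0 f0 u t = u t.
Proof. by rewrite /extend0 ltNge => /negbTE ->. Qed.

Lemma extend0_0 f0 u : extend0 f0 u 0 = f0.
Proof. by rewrite /extend0 lexx. Qed.

Lemma st_L2_extend0 T f0 u : st_L2 T u -> st_L2 T (extend0 f0 u).
Proof.
move=> [mju Lu fin]; split.
- apply: (eq_measurable_fun (fun p => u p.1 p.2)) => //.
  move=> [s x]; rewrite inE /= in_itv /= andbT => -[s0 _].
  by rewrite extend0_gt0.
- by apply: aeS Lu => s Ls /andP[s0 sT]; rewrite extend0_gt0//; apply: Ls; rewrite s0.
- move: fin; apply: le_lt_trans; rewrite le_eqVlt; apply/orP; left; apply/eqP.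
  apply: eq_integral => s; rewrite inE /= in_itv /= => /andP[s0 _].
  by rewrite extend0_gt0.
Qed.

Lemma extend0_H2 t : 0 <= t -> in_H2 (W t) (Wx t) (Wxx t).
Proof.
rewrite le_eqVlt => /predU1P[<-|t0]; first by rewrite !extend0_0.
by rewrite !extend0_gt0//; exact: sr_H2 hreg _ t0.
Qed.

Lemma extend0_w t x : 0 <= t -> 0 <= x <= 1 -> W t x = w t x.
Proof.
rewrite le_eqVlt => /predU1P[<- x01|t0 _]; last by rewrite extend0_gt0.
by rewrite extend0_0 (ws_initial hw)// in_itv.
Qed.

Lemma extend0_continuous t : 0 <= t -> {within `[0, 1], continuous (W t)}.
Proof.
move=> t0; apply: (@subspace_eq_continuous _ _ _ (w t)); last exact: (ws_trace hw).
move=> x; rewrite inE /= in_itv /= => x01; exact/esym/extend0_w.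
Qed.

Lemma L2ip_extend0 t v : 0 <= t -> L2ip (W t) v = L2ip (w t) v.
Proof.
move=> t0; apply: eq_Rintegral => x; rewrite inE /= in_itv /= => /andP[x0 x1].
by rewrite extend0_w// !ltW.
Qed.

Lemma evol_w T : 0 < T -> evol T W wt.
Proof.
move=> T0; have [Hwt _ _] := st_L2_time T.
suff H : evol T w wt.
  move=> v Lv; apply: prim_eq (H v Lv) _ _ => // t t0 tT.
  by rewrite L2ip_extend0.
apply: evol_time_derivative => //; [|exact: ws_continuous hw|exact: ws_time_derivative hw].
move=> t; rewrite le_eqVlt => /predU1P[<-|/(sr_H2 hreg)[[]]//].
have [[Lw0 _ _] _] := hw0; apply/in_L2P.
have E x : 0 < x <= 1 -> w0 x = w 0 x.
  by move=> /andP[/ltW x0 x1]; rewrite (ws_initial hw)// in_itv /= x0.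
split; last by have [_ I] := (in_L2P _).1 Lw0; apply: itg_eq I => x /E ->.
apply: (eq_measurable_fun w0); last exact: in_L2_meas.
by move=> x; rewrite inE /= in_itv /=; exact: E.
Qed.

Lemma evol_wx T : 0 < T -> evol T Wx wxt.
Proof.
move=> T0; have [_ Hwxt _] := st_L2_time T.
apply: evol_weak_derivative (ltW T0) (evol_w T0) _ _ Hwxt.
  by move=> t /andP[t0 _]; have [] := extend0_H2 t0.
by apply: aeS (sr_wt_H2 hreg) => t Ht /andP[t0 _]; have [] := Ht t0.
Qed.

Lemma evol_wxx T : 0 < T -> evol T Wxx wxxt.
Proof.
move=> T0; have [_ _ Hwxxt] := st_L2_time T.
apply: evol_weak_derivative (ltW T0) (evol_wx T0) _ _ Hwxxt.
  by move=> t /andP[t0 _]; have [] := extend0_H2 t0.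
by apply: aeS (sr_wt_H2 hreg) => t Ht /andP[t0 _]; have [] := Ht t0.
Qed.

Lemma extend0_L2 t : 0 <= t -> [/\ in_L2 (W t), in_L2 (Wx t) & in_L2 (Wxx t)].
Proof. by move=> /extend0_H2[[? ? _] []]. Qed.

Lemma energy_w T : 0 < T -> prim T (fun t => L2ip (W t) (W t)) (fun t => 2 * L2ip (W t) (wt t)).
Proof.
move=> T0; have [Hwt _ _] := st_L2_time T; have [Hw _ _] := st_L2_space T.
apply: (evol_energy (evol_w T0) _ Hwt); first exact: st_L2_extend0.
by move=> t /andP[/extend0_L2[]].
Qed.

Lemma energy_wx T : 0 < T ->
  prim T (fun t => L2ip (Wx t) (Wx t)) (fun t => 2 * L2ip (Wx t) (wxt t)).
Proof.
move=> T0; have [_ Hwt _] := st_L2_time T; have [_ Hw _] := st_L2_space T.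
apply: (evol_energy (evol_wx T0) _ Hwt); first exact: st_L2_extend0.
by move=> t /andP[/extend0_L2[]].
Qed.

Lemma energy_wxx T : 0 < T ->
  prim T (fun t => L2ip (Wxx t) (Wxx t)) (fun t => 2 * L2ip (Wxx t) (wxxt t)).
Proof.
move=> T0; have [_ _ Hwt] := st_L2_time T; have [_ _ Hw] := st_L2_space T.
apply: (evol_energy (evol_wxx T0) _ Hwt); first exact: st_L2_extend0.
by move=> t /andP[/extend0_L2[]].
Qed.

Lemma W_prim t : 0 <= t -> prim 1 (W t) (Wx t).
Proof. by move=> t0; apply: H1_prim; [case: (extend0_H2 t0)|exact: extend0_continuous]. Qed.

Lemma wt_good : {ae leb, forall t : R, 0 < t ->
  [/\ in_H2 (wt t) (wxt t) (wxxt t), prim 1 (wt t) (wxt t) &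
    {within `[0, 1], continuous (wt t)}]}.
Proof.
apply: aeS (aeI (sr_wt_H2 hreg) (ws_wt_trace hw)) => t [H1 H2] t0.
by split; [exact: H1|apply: H1_prim; [case: (H1 t0)|exact: H2]|exact: H2].
Qed.

Let trace_meas T x : 0 <= x <= 1 -> measurable_fun (`]0, T] : set R) (fun t => wt t x).
Proof.
move=> x01; have [m1 _ _] := sr_measurable_t hreg.
apply: measurable_funS (jointly_measurable_time x01 m1) => //.
by move=> t /=; rewrite !in_itv /= andbT => /andP[].
Qed.

Lemma trace0_prim T : 0 < T -> prim T (fun t => W t 0) (fun t => wt t 0).
Proof.
move=> T0; have H := primD (evol_w T0 (in_L2_cst 1)) (primZ (-1) (evol_wx T0 in_L2_onem)).
apply: (prim_ae_eq H).
- move=> t t0 _; have [Lw Lwx _] := extend0_L2 t0.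
  by rewrite (trace0E Lw Lwx (W_prim t0)) mulN1r.
- by apply: trace_meas; rewrite lexx ler01.
apply: aeS wt_good => t Ht /andP[/Ht[[[Lwt Lwxt _] _] Hp _] _].
by rewrite (trace0E Lwt Lwxt Hp) mulN1r.
Qed.

Lemma trace1_prim T : 0 < T -> prim T (fun t => W t 1) (fun t => wt t 1).
Proof.
move=> T0; have H := primD (evol_w T0 (in_L2_cst 1)) (evol_wx T0 in_L2_id).
apply: (prim_ae_eq H).
- by move=> t t0 _; have [Lw Lwx _] := extend0_L2 t0; rewrite (trace1E Lw Lwx (W_prim t0)).
- by apply: trace_meas; rewrite lexx ler01.
apply: aeS wt_good => t Ht /andP[/Ht[[[Lwt Lwxt _] _] Hp _] _].
by rewrite (trace1E Lwt Lwxt Hp).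
Qed.

End CleanSolution.

(** * Differential inequalities *)

Section FixedTime.
Variables (R : realType) (mu nu wd c0 c1 : R).
Hypotheses (hmu : 0 < mu) (hnu : 0 < nu) (hwd : 0 <= wd) (hc0 : 0 < c0) (hc1 : 0 < c1).
Notation leb := (@lebesgue_measure R).

Lemma derive1_cubic (p q y : R) :
  derive1 (fun y : R => p * y + q * y ^+ 3) y = p + q * (3 * y ^+ 2).
Proof.
rewrite derive1E deriveD// deriveM// deriveM// !derive_cst derive_id exp_derive.
rewrite /GRing.scale /=; ring.
Qed.

Lemma nu_feedback0 y :
  nu * feedback0 nu wd c0 y = (c0 + 1 + wd) * y + 2 / 9 * c0^-1 * y ^+ 3.
Proof. by rewrite /feedback0; field; rewrite !gt_eqF. Qed.

Lemma nu_feedback1 y :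
  nu * feedback1 nu wd c1 y = - ((c1 + 1 + wd) * y + 2 / 9 * c1^-1 * y ^+ 3).
Proof. by rewrite /feedback1; field; rewrite !gt_eqF. Qed.

Lemma mu_derive1_feedback0 y : mu * (derive1 (feedback0 nu wd c0) y) =
  mu / nu * ((c0 + 1 + wd) + 2 / 3 * c0^-1 * y ^+ 2).
Proof.
have -> : feedback0 nu wd c0 = fun y => (c0 + 1 + wd) / nu * y + 2 / 9 / c0 / nu * y ^+ 3.
  by apply/funext => z; rewrite /feedback0; field; rewrite !gt_eqF.
by rewrite derive1_cubic; field; rewrite !gt_eqF.
Qed.

Lemma mu_derive1_feedback1 y : mu * (derive1 (feedback1 nu wd c1) y) =
  - (mu / nu * ((c1 + 1 + wd) + 2 / 3 * c1^-1 * y ^+ 2)).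
Proof.
have -> : feedback1 nu wd c1 = fun y => (- ((c1 + 1 + wd) / nu)) * y + (- (2 / 9 / c1 / nu)) * y ^+ 3.
  by apply/funext => z; rewrite /feedback1; field; rewrite !gt_eqF.
by rewrite derive1_cubic; field; rewrite !gt_eqF.
Qed.

(* [f] and [g] stand for w(t) and w_t(t) at a fixed time. *)
Variables f fx fxx g gx gxx : R -> R.
Hypotheses (Hf : in_H2 f fx fxx) (Pf : prim 1 f fx)
  (cf : {within `[0, 1], continuous f}).
Hypotheses (Hg : in_H2 g gx gxx) (cg : {within `[0, 1], continuous g}).
Hypothesis pde : forall v vx, in_H1 v vx -> {within `[0, 1], continuous v} ->
  L2ip g v + mu * L2ip gx vx + nu * L2ip fx vx
  + (1 + wd) * L2ip fx v + L2ip (fun x => f x * fx x) v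
  = (mu * (derive1 (feedback1 nu wd c1) (f 1) * g 1) + nu * feedback1 nu wd c1 (f 1)) * v 1
  - (mu * (derive1 (feedback0 nu wd c0) (f 0) * g 0) + nu * feedback0 nu wd c0 (f 0)) * v 0.

Let Lf : in_L2 f. Proof. by case: Hf => -[]. Qed.
Let Lfx : in_L2 fx. Proof. by case: Hf => -[]. Qed.
Let Lfxx : in_L2 fxx. Proof. by case: Hf => _ []. Qed.
Let Lg : in_L2 g. Proof. by case: Hg => -[]. Qed.
Let Lgxx : in_L2 gxx. Proof. by case: Hg => _ []. Qed.
Let Lffx : in_L2 (fun x => f x * fx x).
Proof. exact: in_L2_MH1 Pf _ Lfx. Qed.

(** Test functions vanish at the endpoints, so the feedback terms drop out and the integrations by
    parts can be undone: the equation holds a.e. in x. It can then be tested with w_xx and w_xxt,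
    which have no traces. *)
Lemma pde_strong v : in_L2 v ->
  L2ip g v - mu * L2ip gxx v - nu * L2ip fxx v
  + (1 + wd) * L2ip fx v + L2ip (fun x => f x * fx x) v = 0.
Proof.
move=> Lv.
pose h x := g x - mu * gxx x - nu * fxx x + (1 + wd) * fx x + f x * fx x.
have Lh : in_L2 h.
  exact: (in_L2D (in_L2D (in_L2B (in_L2B Lg (in_L2Z mu Lgxx)) (in_L2Z nu Lfxx))
    (in_L2Z (1 + wd) Lfx)) Lffx).
have Eh u : in_L2 u -> L2ip h u = L2ip g u - mu * L2ip gxx u - nu * L2ip fxx u
  + (1 + wd) * L2ip fx u + L2ip (fun x => f x * fx x) u.
  move=> Lu; have L1 := in_L2Z mu Lgxx; have L2 := in_L2Z nu Lfxx.
  have L3 := in_L2Z (1 + wd) Lfx; have L4 := in_L2B Lg L1.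
  have L5 := in_L2B L4 L2; have L6 := in_L2D L5 L3.
  by rewrite /h L2ipDl// L2ipDl// L2ipBl// L2ipBl// !L2ipZl.
rewrite -Eh//; have mh := in_L2_meas Lh; have mv := in_L2_meas Lv.
have h0 : {ae leb, forall x, 0 < x < 1 -> h x = 0}.
  apply: fundamental_lemma => //; first exact: in_L2_itg.
  move=> phi Tphi; have Hphi := test_function_H1 Tphi.
  have [Lphi Lphi' _] := Hphi.
  rewrite -L2ipE//; last exact: in_L2_meas.
  rewrite Eh//.
  have cphi : {within `[0, 1], continuous phi}.
    by apply: continuous_subspaceT; exact: test_function_continuous Tphi.
  have := pde Hphi cphi.
  have -> : phi 0 = 0 by apply: (test_function_out Tphi); rewrite /= in_itv /= ltxx.
  have -> : phi 1 = 0 by apply: (test_function_out Tphi); rewrite /= in_itv /= ltxx andbF.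
  have [_ [_ _ Wfx]] := Hf; have [_ [_ _ Wgx]] := Hg.
  rewrite (weak_derivative_L2ip Wfx Tphi) (weak_derivative_L2ip Wgx Tphi).
  rewrite !mulr0 subrr => <-; ring.
rewrite L2ipE// -[RHS](_ : pint 0 1 (fun=> 0) = 0); last by rewrite pint_cst// mul0r.
apply: pint_ae_eq => //; first exact: measurable_funM.
by apply: ae_itv_oc; apply: aeS h0 => x hx /hx ->; rewrite mul0r.
Qed.

(* Absorbs the cubic boundary term that w w_x contributes. *)
Let bdry_sq (c y : R) : 0 < c -> 0 <= c * y ^+ 2 + 2 / 3 * y ^+ 3 + c^-1 / 9 * y ^+ 4.
Proof.
move=> c_gt0.
have -> : c * y ^+ 2 + 2 / 3 * y ^+ 3 + c^-1 / 9 * y ^+ 4 = c * (y + y ^+ 2 / 3 / c) ^+ 2.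
  by field; rewrite gt_eqF.
by rewrite mulr_ge0 ?sqr_ge0// ltW.
Qed.

Let k0 := c0 + 1 + wd.
Let k1 := c1 + 1 + wd.

(** Test with w and double. The cubic feedback contributes 4/9 of [c^-1 y^4] at each end: 1/9
    completes the square that absorbs the cubic term, and the remaining 1/3 is the quartic part of
    E_1. At x = 0 the transport term uses up [1 + wd], while [c0] goes into the square. *)
Lemma energy_ineq1 :
  2 * L2ip f g + mu * (2 * L2ip fx gx)
  + mu / nu * (2 * k0 * (f 0 * g 0) + 4 / 3 * c0^-1 * (f 0 ^+ 3 * g 0)
             + (2 * k1 * (f 1 * g 1) + 4 / 3 * c1^-1 * (f 1 ^+ 3 * g 1)))
  <= - (2 * nu * L2ip fx fx)
     - (k0 * f 0 ^+ 2 + c0^-1 / 3 * f 0 ^+ 4 + (k1 * f 1 ^+ 2 + c1^-1 / 3 * f 1 ^+ 4)).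
Proof.
have [Hfx _] := Hf; have := pde Hfx cf.
rewrite !mulrDl !(mulrA mu) mu_derive1_feedback0 mu_derive1_feedback1 nu_feedback0 nu_feedback1.
have := congr1 ( *%R (1 + wd)) (L2ip_derive_sq Lf Lfx Pf); have := L2ip_derive_cube Lf Lfx Pf.
rewrite (L2ipC g f) (L2ipC gx fx) -/k0 -/k1.
have := bdry_sq (f 1) hc1; have := bdry_sq (- f 0) hc0.
have := sqr_ge0 (f 1); have : 0 <= wd * f 1 ^+ 2 by rewrite mulr_ge0 ?sqr_ge0.
rewrite /k0 /k1; lra.
Qed.

Variable S : R.
Hypothesis hS : forall x, 0 < x <= 1 -> f x ^+ 2 <= S.

Let L2ip_ffx : L2ip (fun x => f x * fx x) (fun x => f x * fx x) <= S * L2ip fx fx.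
Proof.
have mf := in_L2_meas Lffx; have mfx := in_L2_meas Lfx.
rewrite !L2ipE// -pintZ; last exact: in_L2_itgM.
apply: pint_le; [exact: in_L2_itgM|exact/itgZ/in_L2_itgM|].
move=> x x01; rewrite -!expr2 exprMn ler_wpM2r ?sqr_ge0//; exact: hS.
Qed.

Let kappa := (1 + wd) ^+ 2 + S.

(** Test with w_t and double. The time-differentiated feedback law acts as boundary damping, which
    is E_3. Young's weight 2 charges half of [||w_t||^2] to each of the two convective terms, so one
    of the two copies survives. *)
Lemma energy_ineq2 :
  nu * (2 * L2ip fx gx)
  + (2 * k0 * (f 0 * g 0) + 4 / 9 * c0^-1 * (f 0 ^+ 3 * g 0)
     + (2 * k1 * (f 1 * g 1) + 4 / 9 * c1^-1 * (f 1 ^+ 3 * g 1)))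
  <= - L2ip g g - 2 * mu * L2ip gx gx
     - 2 * (mu / nu) * ((k0 + 2 / 3 * c0^-1 * f 0 ^+ 2) * g 0 ^+ 2
                     + (k1 + 2 / 3 * c1^-1 * f 1 ^+ 2) * g 1 ^+ 2)
     + 2 * kappa * L2ip fx fx.
Proof.
have [Hgx _] := Hg; have := pde Hgx cg.
rewrite !mulrDl !(mulrA mu) mu_derive1_feedback0 mu_derive1_feedback1 nu_feedback0 nu_feedback1.
have e2 : (0 : R) < 2 by [].
have := L2ip_young e2 (in_L2Z (1 + wd) Lfx) Lg; have := L2ip_young e2 Lffx Lg.
have L1 := in_L2Z (1 + wd) Lfx.
rewrite L2ipZl// L2ipZl// L2ipZr//.
have := ler_norm (- L2ip (fun x => f x * fx x) g).
have := ler_norm (- ((1 + wd) * L2ip fx g)); rewrite !normrN.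
move: L2ip_ffx; rewrite /kappa /k0 /k1; lra.
Qed.

Lemma energy_ineq3 :
  mu * (2 * L2ip fxx gxx) <= - (nu * L2ip fxx fxx)
    + 3 / nu * (L2ip g g + kappa * L2ip fx fx).
Proof.
have := pde_strong Lfxx; rewrite (L2ipC gxx fxx).
(* Three terms are paired with w_xx, each charged [nu / 3]; of the dissipation [2 nu ||w_xx||^2] one
   half survives. *)
have n3 : 0 < 3 / nu by rewrite divr_gt0.
have L1 := in_L2Z (1 + wd) Lfx.
have := L2ip_young n3 L1 Lfxx; have := L2ip_young n3 Lffx Lfxx; have := L2ip_young n3 Lg Lfxx.
rewrite L2ipZl// L2ipZl// L2ipZr// invf_div.
have := ler_norm (L2ip g fxx); have := ler_norm (L2ip (fun x => f x * fx x) fxx).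
have := ler_norm ((1 + wd) * L2ip fx fxx).
have := ler_wpM2l (ltW n3) L2ip_ffx; rewrite /kappa; lra.
Qed.

Lemma energy_ineq4 :
  mu ^+ 2 * L2ip gxx gxx <=
    4 * (L2ip g g + nu ^+ 2 * L2ip fxx fxx + kappa * L2ip fx fx).
Proof.
have := pde_strong Lgxx; have L1 := in_L2Z (1 + wd) Lfx.
(* Four terms are paired with w_xxt, each charged [mu / 4]. The equation thus recovers [||w_xxt||],
   which none of the dissipation terms contains. *)
have m4 : 0 < 4 / mu by rewrite divr_gt0.
have := L2ip_young m4 L1 Lgxx; have := L2ip_young m4 Lffx Lgxx; have := L2ip_young m4 Lg Lgxx.
have := L2ip_young m4 (in_L2Z (- nu) Lfxx) Lgxx.
have L2 := in_L2Z (- nu) Lfxx.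
rewrite !L2ipZl// !L2ipZr// invf_div.
have := ler_norm (L2ip g gxx); have := ler_norm (L2ip (fun x => f x * fx x) gxx).
have := ler_norm ((1 + wd) * L2ip fx gxx); have := ler_norm (- nu * L2ip fxx gxx).
have h := ler_wpM2l (ltW m4) L2ip_ffx.
move=> *; have : mu * L2ip gxx gxx <=
    4 / mu * (L2ip g g + nu ^+ 2 * L2ip fxx fxx + kappa * L2ip fx fx).
  by move: h; rewrite /kappa; lra.
move=> /(ler_wpM2l (ltW hmu)); rewrite mulrA -expr2 => /le_trans; apply.
by rewrite le_eqVlt; apply/orP; left; apply/eqP; field; rewrite gt_eqF.
Qed.

End FixedTime.

(** * Real inequalities behind the decay estimates *)

Section Algebra.
Variable R : realType.

Lemma prim_expR_mul T k (V v : R -> R) : 0 <= T -> prim T V v ->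
  prim T (fun t => expR (k * t) * V t) (fun t => expR (k * t) * (v t + k * V t)).
Proof.
move=> T0 HV.
have dE (t : R) : is_derive t 1 (fun t => expR (k * t)) (k * expR (k * t)).
  by apply: is_derive_eq; rewrite /GRing.scale /= ; ring.
have E' : derive1 (fun t => expR (k * t)) = fun t => k * expR (k * t).
  by apply/funext => t; rewrite derive1E derive_val.
have HE : prim T (fun t => expR (k * t)) (fun t => k * expR (k * t)).
  rewrite -E'; apply: prim_C1; first by move=> t; apply: ex_derive.
  rewrite E' => t; apply: cvgM; first exact: cvg_cst.
  by apply: continuous_comp; [apply: cvgM; [exact: cvg_cst|exact: cvg_id]|exact: continuous_expR].
apply: prim_eq (primM T0 HE HV) _ _ => // t _.
by ring.
Qed.

(** Of [2 nu N1], the rate condition on [mu + 1] lets the Poincare term and [mu N1] consume 9/8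
    [nu N1]. At the boundary the margin is [eta], a quarter of the gap between [mu / (mu + 1)] and
    1. *)
Lemma decay_ineq1 (mu nu al k0 k1 i0 i1 N0 N1 a b dV : R) :
  0 < mu -> 0 < nu -> 0 <= al -> 0 < k0 -> 0 < k1 -> 0 < i0 -> 0 < i1 -> 0 <= N1 ->
  2 * al * (mu + 1) <= nu -> 2 * al * (nu + k0 * mu) <= nu * k0 ->
  2 * al * (nu + k1 * mu) <= nu * k1 ->
  N0 <= 3 / 4 * (a ^+ 2 + b ^+ 2) + 9 / 8 * N1 ->
  let e1 := k0 * a ^+ 2 + i0 / 3 * a ^+ 4 + (k1 * b ^+ 2 + i1 / 3 * b ^+ 4) in
  dV <= - (2 * nu * N1) - e1 ->
  dV + 2 * al * (N0 + mu * N1 + mu / nu * e1) <= - (7 / 8 * nu * N1) - e1 / (4 * (mu + 1)).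
Proof.
move=> mu0 nu0 al0 k00 k10 i00 i10 N10 h h0 h1 hN e1 hV.
have a2 := sqr_ge0 a; have b2 := sqr_ge0 b.
have a4 : 0 <= a ^+ 4 by rewrite (exprM a 2 2) sqr_ge0.
have b4 : 0 <= b ^+ 4 by rewrite (exprM b 2 2) sqr_ge0.
have hN1 : 2 * al * (N0 + mu * N1) <= 2 * al * (3 / 4 * (a ^+ 2 + b ^+ 2)) + 9 / 8 * nu * N1.
  have q1 := ler_wpM2l (mulr_ge0 (ler0n _ 2) al0) hN.
  have q2 := ler_wpM2r N10 h.
  have q3 : 0 <= al * mu * N1 by rewrite !mulr_ge0// ltW.
  lra.
pose eta := (4 * (mu + 1))^-1.
have eta0 : 0 < eta by rewrite invr_gt0 mulr_gt0// addr_gt0.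
have etaE : 4 * (mu + 1) * eta = 1 by rewrite mulfV// gt_eqF// mulr_gt0// addr_gt0.
have r0 : 0 < nu^-1 by rewrite invr_gt0.
have nuE : nu * nu^-1 = 1 by rewrite mulfV// gt_eqF.
have hm : 2 * al * (mu / nu) <= 1 - 4 * eta.
  have q := ler_wpM2l (mulr_ge0 (ltW mu0) (ltW (mulr_gt0 r0 eta0))) h.
  have -> : 2 * al * (mu / nu) = 4 * (mu * (nu^-1 * eta) * (2 * al * (mu + 1))).
    have -> : 4 * (mu * (nu^-1 * eta) * (2 * al * (mu + 1))) = 2 * al * (mu / nu) * (4 * (mu + 1) * eta) by ring.
    by rewrite etaE mulr1.
  have : 4 * (mu * (nu^-1 * eta) * nu) = 1 - 4 * eta.
    have -> : 4 * (mu * (nu^-1 * eta) * nu) = (4 * (mu + 1) * eta - 4 * eta) * (nu * nu^-1) by ring.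
    by rewrite nuE etaE mulr1.
  lra.
(* Convex combination: 3/4 of the rate condition for [k], which is sharp at the extremal rate, plus
   1/4 of [hm], which has the slack [4 * eta]. *)
have hq (k y : R) : 0 < k -> 0 <= y -> 2 * al * (nu + k * mu) <= nu * k ->
    2 * al * (3 / 4 * y) + 2 * al * (mu / nu) * (k * y) <= (1 - eta) * (k * y).
  move=> kpos y0 hk.
  have q1 : 2 * al * (y + mu / nu * k * y) <= k * y.
    have := ler_wpM2r (mulr_ge0 y0 (ltW r0)) hk.
    have -> : 2 * al * (nu + k * mu) * (y * nu^-1) = 2 * al * (y * (nu * nu^-1) + mu / nu * k * y) by ring.
    have -> : nu * k * (y * nu^-1) = k * y * (nu * nu^-1) by ring.
    by rewrite nuE !mulr1.
  have q2 := ler_wpM2r (mulr_ge0 (ltW kpos) y0) hm.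
  lra.
have hf (i y : R) : 0 < i -> 0 <= y -> 2 * al * (mu / nu) * (i / 3 * y) <= (1 - eta) * (i / 3 * y).
  move=> ipos y0; apply: ler_wpM2r; last lra.
  by rewrite mulr_ge0// divr_ge0// ltW.
have := hq k0 _ k00 a2 h0; have := hq k1 _ k10 b2 h1.
have := hf i0 _ i00 a4; have := hf i1 _ i10 b4.
rewrite -[e1 / _]/(e1 * eta); move: hV hN1; rewrite /e1; lra.
Qed.

(** Here [N1], [N2] stand for the squared norms of w_x, w_xx and [M0], [M1], [M2] for those of w_t,
    w_xt, w_xxt. [Q] exceeds by 1 the factor [3 / nu] with which the third estimate loses [M0]. The
    first part of [P] pays for all leftover multiples of [N1], the second for the boundary part of
    [2 al Q V2]. *)
Lemma decay_ineq (mu nu al kappa eta e1 e2 e3 N1 N2 M0 M1 M2 V1 dV1 dV2 dV3 : R) :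
  0 < mu -> 0 < nu -> 0 <= al -> 0 <= kappa -> 0 < eta ->
  2 * al * (mu + 1) <= nu ->
  0 <= e1 -> e2 <= e1 -> 0 <= e3 -> 0 <= N1 -> 0 <= N2 -> 0 <= M0 -> 0 <= M1 -> 0 <= M2 ->
  dV1 + 2 * al * V1 <= - (7 / 8 * nu * N1) - eta * e1 ->
  dV2 <= - M0 - 2 * mu * M1 - 2 * (mu / nu) * e3 + 2 * kappa * N1 ->
  dV3 <= - (nu * N2) + 3 / nu * (M0 + kappa * N1) ->
  mu ^+ 2 * M2 <= 4 * (M0 + nu ^+ 2 * N2 + kappa * N1) ->
  forall Q P L, Q = 3 / nu + 1 ->
  P = 8 / (7 * nu) * (Q * (2 * kappa + nu ^+ 2) + 3 * kappa / nu + 1) + Q * nu / eta ->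
  L = 1 / (mu * Q) + 4 / mu + 4 * nu * (mu + 1) / mu + 4 * kappa / mu ->
  M1 + mu * M2 + 2 / nu * e3 <=
  L * - (P * dV1 + Q * dV2 + dV3 + 2 * al * (P * V1 + Q * (nu * N1 + e2) + mu * N2)).
Proof.
move=> mu0 nu0 al0 kappa0 eta0 h e10 e21 e30 N10 N20 M00 M10 M20 h1 h2 h3 h4 Q P L QE PE LE.
have mu10 : 0 < mu + 1 by rewrite addr_gt0.
have Q0 : 0 < Q by rewrite QE addr_gt0// divr_gt0.
pose Z := Q * (2 * kappa + nu ^+ 2) + 3 * kappa / nu + 1.
have Z0 : 0 < Z.
  apply: ltr_wpDl => //; apply: addr_ge0.
    by apply: mulr_ge0; [exact: ltW|apply: addr_ge0; [exact: mulr_ge0|exact: sqr_ge0]].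
  by apply: divr_ge0; [exact: mulr_ge0|exact: ltW].
have P0 : 0 < P.
  rewrite PE -/Z; apply: addr_gt0; last by apply: divr_gt0 => //; exact: mulr_gt0.
  by apply: mulr_gt0 => //; apply: divr_gt0 => //; exact: mulr_gt0.
have PN : P * (7 / 8 * nu) = Z + 7 / 8 * nu * (Q * nu / eta).
  by rewrite PE -/Z; field; rewrite !gt_eqF.
have Peta : P * eta = 8 / (7 * nu) * Z * eta + Q * nu.
  by rewrite PE -/Z; field; rewrite !gt_eqF.
have alnu : 2 * al <= nu.
  have : 0 <= al * mu by rewrite mulr_ge0// ltW.
  lra.
have almu : 2 * al * mu <= nu - nu / (mu + 1).
  have -> : nu - nu / (mu + 1) = nu / (mu + 1) * mu by field; rewrite gt_eqF.
  by rewrite ler_wpM2r ?(ltW mu0)// ler_pdivlMr.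
(* What survives of the dissipation. The weight of [N2] is [nu - 2 al mu], bounded below by
   [nu / (mu + 1)]. In [L] the first summand pays for [M1] and [e3]; the other three pay for
   [mu * M2] through the bound [h4]. *)
pose G := M0 + 2 * mu * Q * M1 + 2 * (mu / nu) * Q * e3 + N1 + nu / (mu + 1) * N2.
have stepG : P * dV1 + Q * dV2 + dV3 + 2 * al * (P * V1 + Q * (nu * N1 + e2) + mu * N2) <= - G.
  have t1 := ler_wpM2l (ltW P0) h1.
  have t2 := ler_wpM2l (ltW Q0) h2.
  have t3 : Q * (2 * al * (nu * N1 + e2)) <= Q * (nu * (nu * N1 + e1)).
    rewrite ler_wpM2l ?(ltW Q0)//; apply: (@le_trans _ _ (2 * al * (nu * N1 + e1))).
      by rewrite ler_wpM2l ?mulr_ge0// lerD2l.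
    by rewrite ler_wpM2r// addr_ge0// mulr_ge0// ltW.
  have t4 := ler_wpM2r N20 almu.
  have t5 : (Z + 7 / 8 * nu * (Q * nu / eta)) * N1 >= Z * N1.
    rewrite ler_wpM2r// lerDl; apply: mulr_ge0; first by rewrite mulr_ge0// ltW.
    by apply: divr_ge0; [apply: mulr_ge0|]; exact: ltW.
  have t6 : (8 / (7 * nu) * Z * eta + Q * nu) * e1 >= Q * nu * e1.
    rewrite ler_wpM2r// lerDr; apply: mulr_ge0; last exact: ltW.
    by apply: mulr_ge0; [apply: divr_ge0; rewrite // mulr_ge0// ltW|exact: ltW].
  rewrite -PN in t5; rewrite -Peta in t6.
  have t7 : Q * M0 = 3 / nu * M0 + M0 by rewrite QE; ring.
  rewrite /G; rewrite /Z in t5; lra.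
have L1 : 0 <= 1 / (mu * Q) by rewrite divr_ge0// mulr_ge0// ltW.
have L2 : 0 <= 4 / mu by rewrite divr_ge0// ltW.
have L3 : 0 <= 4 * nu * (mu + 1) / mu by rewrite divr_ge0 ?(ltW mu0)// !mulr_ge0// ltW.
have L4 : 0 <= 4 * kappa / mu by rewrite divr_ge0 ?(ltW mu0)// mulr_ge0.
have L0 : 0 <= L by rewrite LE !addr_ge0.
apply: (@le_trans _ _ (L * G)); last by rewrite ler_wpM2l// lerNr.
have muM2 : mu * M2 <= 4 / mu * (M0 + nu ^+ 2 * N2 + kappa * N1).
  have -> : mu * M2 = mu ^+ 2 * M2 / mu by field; rewrite gt_eqF.
  rewrite ler_pdivrMr//; apply: (le_trans h4); rewrite le_eqVlt; apply/orP; left.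
  by apply/eqP; field; rewrite gt_eqF.
pose g1 := 2 * mu * Q * M1 + 2 * (mu / nu) * Q * e3.
pose g4 := nu / (mu + 1) * N2.
have g10 : 0 <= g1.
  by apply: addr_ge0; rewrite !mulr_ge0 ?(ltW Q0) ?(ltW mu0)// invr_ge0 ltW.
have g40 : 0 <= g4 by rewrite mulr_ge0// divr_ge0// ltW.
have GE : G = M0 + g1 + N1 + g4 by rewrite /G /g1 /g4; ring.
have E1 : 1 / (mu * Q) * g1 = 2 * M1 + 2 / nu * e3.
  by rewrite /g1; field; rewrite !gt_eqF.
have E3 : 4 * nu * (mu + 1) / mu * g4 = 4 / mu * (nu ^+ 2 * N2).
  by rewrite /g4; field; rewrite !gt_eqF.
have E4 : 4 * kappa / mu * N1 = 4 / mu * (kappa * N1) by ring.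
have F1 : 1 / (mu * Q) * g1 <= 1 / (mu * Q) * G by rewrite ler_wpM2l// GE; lra.
have F2 : 4 / mu * M0 <= 4 / mu * G by rewrite ler_wpM2l// GE; lra.
have F3 : 4 * nu * (mu + 1) / mu * g4 <= 4 * nu * (mu + 1) / mu * G.
  by rewrite ler_wpM2l// GE; lra.
have F4 : 4 * kappa / mu * N1 <= 4 * kappa / mu * G by rewrite ler_wpM2l// GE; lra.
rewrite LE !mulrDl; rewrite E1 in F1; rewrite E3 in F3; rewrite E4 in F4.
rewrite !mulrDr in muM2; lra.
Qed.

End Algebra.

(** * The Lyapunov functional and its exponential decay *)

Section ClosedLoopDecay.
Variables (R : realType) (mu nu wd c0 c1 alpha : R).
Hypotheses (hmu : 0 < mu) (hnu : 0 < nu) (hwd : 0 <= wd) (hc0 : 0 < c0) (hc1 : 0 < c1).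
Hypotheses (halpha0 : 0 <= alpha) (halpha : alpha <= decay_rate_bound mu nu wd c0 c1).
Variables (w0 w0x w0xx : R -> R).
Hypothesis hw0 : in_H2 w0 w0x w0xx.
Variables (w wx wxx wt wxt wxxt : R -> R -> R).
Hypothesis hw : weak_solution mu nu wd c0 c1 w0 w wx wt wxt.
Hypothesis hreg : standing_regularity mu w wx wxx wt wxt wxxt.
Notation leb := (@lebesgue_measure R).
Local Notation W := (extend0 w0 w).
Local Notation Wx := (extend0 w0x wx).
Local Notation Wxx := (extend0 w0xx wxx).
Local Notation k0 := (c0 + 1 + wd).
Local Notation k1 := (c1 + 1 + wd).

Let k00 : 0 < k0. Proof. by move: hc0 hwd; lra. Qed.
Let k10 : 0 < k1. Proof. by move: hc1 hwd; lra. Qed.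
Let i00 : 0 < c0^-1. Proof. by rewrite invr_gt0. Qed.
Let i10 : 0 < c1^-1. Proof. by rewrite invr_gt0. Qed.

Let rate : [/\ 2 * alpha * (mu + 1) <= nu, 2 * alpha * (nu + k0 * mu) <= nu * k0 &
  2 * alpha * (nu + k1 * mu) <= nu * k1].
Proof.
have mu1 : 0 < mu + 1 by rewrite addr_gt0.
have d0 : 0 < nu + k0 * mu by rewrite addr_gt0// mulr_gt0.
have d1 : 0 < nu + k1 * mu by rewrite addr_gt0// mulr_gt0.
move: halpha; rewrite /decay_rate_bound (addrC 1 c0) (addrC 1 c1).
set m := Num.min _ _ => h.
have h2 : 2 * alpha <= m by lra.
split; rewrite -ler_pdivlMr//; apply: (le_trans h2); rewrite /m !ge_min.
- by rewrite lexx.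
- by rewrite lexx !orbT.
- by rewrite lexx !orbT.
Qed.

Let good_time : {ae leb, forall t : R, 0 < t ->
  [/\ in_H2 (wt t) (wxt t) (wxxt t), {within `[0, 1], continuous (wt t)} &
  forall v vx, in_H1 v vx -> {within `[0, 1], continuous v} ->
  L2ip (wt t) v + mu * L2ip (wxt t) vx + nu * L2ip (Wx t) vx
  + (1 + wd) * L2ip (Wx t) v + L2ip (fun x => W t x * Wx t x) v
  = (mu * (derive1 (feedback1 nu wd c1) (W t 1) * wt t 1) + nu * feedback1 nu wd c1 (W t 1)) * v 1
  - (mu * (derive1 (feedback0 nu wd c0) (W t 0) * wt t 0) + nu * feedback0 nu wd c0 (W t 0)) * v 0]}.
Proof.
apply: aeS (aeI (wt_good hw hreg) (ws_equation hw)) => t [H1 H2] t0.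
have [Hwt _ cwt] := H1 t0; split => // v vx Hv cv.
by rewrite !extend0_gt0//; exact: H2.
Qed.

Let N0 t := L2ip (W t) (W t).
Let N1 t := L2ip (Wx t) (Wx t).
Let N2 t := L2ip (Wxx t) (Wxx t).

(** This is E_1. Its derivative is twice w times nu times the time-differentiated feedback, summed
    over both ends, which is why [mu / nu] times it completes V1. *)
Let e1 t := k0 * W t 0 ^+ 2 + c0^-1 / 3 * W t 0 ^+ 4 +
  (k1 * W t 1 ^+ 2 + c1^-1 / 3 * W t 1 ^+ 4).
Let de1 t := 2 * k0 * (W t 0 * wt t 0) + 4 / 3 * c0^-1 * (W t 0 ^+ 3 * wt t 0)
  + (2 * k1 * (W t 1 * wt t 1) + 4 / 3 * c1^-1 * (W t 1 ^+ 3 * wt t 1)).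
(** Boundary part of V2: the feedback is tested with w_t without being differentiated, and twice the
    primitive of [2/9 c^-1 y^3] has the coefficient 1/9 instead of 1/3. *)
Let e2 t := k0 * W t 0 ^+ 2 + c0^-1 / 9 * W t 0 ^+ 4 +
  (k1 * W t 1 ^+ 2 + c1^-1 / 9 * W t 1 ^+ 4).
Let de2 t := 2 * k0 * (W t 0 * wt t 0) + 4 / 9 * c0^-1 * (W t 0 ^+ 3 * wt t 0)
  + (2 * k1 * (W t 1 * wt t 1) + 4 / 9 * c1^-1 * (W t 1 ^+ 3 * wt t 1)).

Let quartic_prim T p q (y y' : R -> R) : 0 < T -> prim T y y' ->
  prim T (fun t => p * y t ^+ 2 + q * y t ^+ 4)
    (fun t => 2 * p * (y t * y' t) + 4 * q * (y t ^+ 3 * y' t)).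
Proof.
move=> /ltW T0 Hy; have H2 := primM T0 Hy Hy; have H4 := primM T0 H2 H2.
by apply: prim_eq (primD (primZ p H2) (primZ q H4)) _ _ => t *; ring.
Qed.

Let e1_prim T : 0 < T -> prim T e1 de1.
Proof.
move=> T0; have H0 := trace0_prim hmu hw0 hw hreg T0.
have H1 := trace1_prim hmu hw0 hw hreg T0.
apply: prim_eq (primD (quartic_prim k0 (c0^-1 / 3) T0 H0) (quartic_prim k1 (c1^-1 / 3) T0 H1)) _ _ => t * //.
by rewrite /de1; ring.
Qed.

Let e2_prim T : 0 < T -> prim T e2 de2.
Proof.
move=> T0; have H0 := trace0_prim hmu hw0 hw hreg T0.
have H1 := trace1_prim hmu hw0 hw hreg T0.
apply: prim_eq (primD (quartic_prim k0 (c0^-1 / 9) T0 H0) (quartic_prim k1 (c1^-1 / 9) T0 H1)) _ _ => t * //.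
by rewrite /de2; ring.
Qed.

Let pow4_ge0 (y : R) : 0 <= y ^+ 4. Proof. by rewrite (exprM y 2 2) sqr_ge0. Qed.

Let e2_ge0 t : 0 <= e2 t.
Proof.
by rewrite /e2 !addr_ge0// mulr_ge0 ?sqr_ge0 ?pow4_ge0// ?divr_ge0 ?ltW.
Qed.

Let e2_le_e1 t : e2 t <= e1 t.
Proof.
have := mulr_ge0 (ltW i00) (pow4_ge0 (W t 0)).
have := mulr_ge0 (ltW i10) (pow4_ge0 (W t 1)).
rewrite /e1 /e2; lra.
Qed.

Let e1_ge0 t : 0 <= e1 t.
Proof. exact: le_trans (e2_ge0 t) (e2_le_e1 t). Qed.

Let V1 t := N0 t + mu * N1 t + mu / nu * e1 t.
Let v1 t := 2 * L2ip (W t) (wt t) + mu * (2 * L2ip (Wx t) (wxt t)) + mu / nu * de1 t.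

Let V1_prim T : 0 < T -> prim T V1 v1.
Proof.
move=> T0; apply: primD (primZ _ (e1_prim T0)).
exact: primD (energy_w hmu hw0 hw hreg T0) (primZ _ (energy_wx hmu hw0 hw hreg T0)).
Qed.

Let v1_ineq : {ae leb, forall t, 0 < t -> v1 t <= - (2 * nu * N1 t) - e1 t}.
Proof.
apply: aeS good_time => t Ht t0; have [Hwt cwt pde] := Ht t0.
have Hf := extend0_H2 hw0 hreg (ltW t0); have Pf := W_prim hw0 hw hreg (ltW t0).
have cf : {within `[0, 1], continuous (W t)} by apply: (extend0_continuous hw); exact: ltW.
exact: (energy_ineq1 hnu hwd hc0 hc1 Hf Pf cf pde).
Qed.

Let N1_ge0 t : 0 <= N1 t. Proof. exact: L2ip_ge0. Qed.

Let V1_decr t : 0 <= t -> V1 t <= V1 0.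
Proof.
rewrite le_eqVlt => /predU1P[<-//|t0]; have [I1 H1] := V1_prim t0.
rewrite -subr_le0 (H1 _ _ (lexx 0) (ltW t0) (lexx t)).
apply: (@le_trans _ _ (pint 0 t (fun=> 0))); last by rewrite pint_cst ?mul0r// ltW.
apply: pint_ae_le => //; first exact: itg_cst.
apply: aeS v1_ineq => s hs /andP[/hs h _]; apply: (le_trans h).
have := e1_ge0 s; have : 0 <= nu * N1 s by rewrite mulr_ge0// ltW.
lra.
Qed.

(** V1 is nonincreasing and controls both the trace at 0 and w_x, hence the supremum of w.
    Uniformity in time matters because [B] enters [kappa], and through it [P] and [L]. *)
Let sup_bound : exists2 B, 0 <= B & forall t x, 0 <= t -> 0 < x <= 1 -> W t x ^+ 2 <= B.
Proof.
have V10 : 0 <= V1 0.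
  apply: addr_ge0; last by apply: mulr_ge0; [apply: divr_ge0; exact: ltW|exact: e1_ge0].
  by apply: addr_ge0; [exact: L2ip_ge0|apply: mulr_ge0; [exact: ltW|exact: N1_ge0]].
exists (2 * (nu / (mu * k0) * V1 0) + 2 * (V1 0 / mu)).
  have : 0 <= nu / (mu * k0) * V1 0.
    by apply: mulr_ge0 => //; apply: divr_ge0; [exact: ltW|apply: mulr_ge0; exact: ltW].
  have : 0 <= V1 0 / mu by apply: divr_ge0 => //; exact: ltW.
  lra.
move=> t x t0 /andP[x0 x1]; have [Lw Lwx _] := extend0_L2 hw0 hreg t0.
have h := H1_sup Lwx (W_prim hw0 hw hreg t0) (ltW x0) x1.
apply: (le_trans h); have hV := V1_decr t0.
have n0 : 0 <= N0 t := L2ip_ge0 _.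
have m1 : 0 <= mu * N1 t by apply: mulr_ge0; [exact: ltW|exact: N1_ge0].
have m2 : 0 <= mu / nu * e1 t.
  by apply: mulr_ge0; [apply: divr_ge0; exact: ltW|exact: e1_ge0].
apply: lerD; rewrite ler_wpM2l//; last first.
  rewrite ler_pdivlMr// mulrC; rewrite /V1 in hV *.
  by apply: le_trans hV; rewrite -/(N1 t); lra.
have ka : mu / nu * (k0 * W t 0 ^+ 2) <= V1 0.
  apply: le_trans hV; apply: (@le_trans _ _ (mu / nu * e1 t)); last by rewrite /V1; lra.
  apply: ler_wpM2l; first by apply: divr_ge0; exact: ltW.
  have := mulr_ge0 (ltW i00) (pow4_ge0 (W t 0)).
  have := mulr_ge0 (ltW i10) (pow4_ge0 (W t 1)).
  have := mulr_ge0 (ltW k10) (sqr_ge0 (W t 1)).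
  rewrite /e1; lra.
have nk : 0 <= nu / (mu * k0) by apply: divr_ge0; [exact: ltW|apply: mulr_ge0; exact: ltW].
have := ler_wpM2l nk ka.
have -> // : nu / (mu * k0) * (mu / nu * (k0 * W t 0 ^+ 2)) = W t 0 ^+ 2.
by field; rewrite !gt_eqF.
Qed.

Let e3 t := (k0 + 2 / 3 * c0^-1 * W t 0 ^+ 2) * wt t 0 ^+ 2
  + (k1 + 2 / 3 * c1^-1 * W t 1 ^+ 2) * wt t 1 ^+ 2.

Let e3_ge0 t : 0 <= e3 t.
Proof.
have h (k i y z : R) : 0 < k -> 0 < i -> 0 <= (k + 2 / 3 * i * y ^+ 2) * z ^+ 2.
  move=> kpos ipos; apply: mulr_ge0; last exact: sqr_ge0.
  have := mulr_ge0 (ltW ipos) (sqr_ge0 y); lra.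
by apply: addr_ge0; exact: h.
Qed.

(* [P] is chosen large with respect to [Q], so that the dissipation of [V1]
   absorbs the terms that the w_t- and w_xx-estimates leave over. *)
Lemma lyapunov : exists P Q L : R, [/\ 0 < P, 0 < Q, 0 < L &
  forall T, 0 < T -> exists v : R -> R,
    let V t := P * V1 t + Q * (nu * N1 t + e2 t) + mu * N2 t in
    prim T V v /\
    {ae leb, forall t, 0 < t -> L2ip (wxt t) (wxt t) + mu * L2ip (wxxt t) (wxxt t)
        + 2 / nu * e3 t <= L * - (v t + 2 * alpha * V t)}].
Proof.
have [B B0 hB] := sup_bound.
have [r1 r2 r3] := rate.
pose kappa := (1 + wd) ^+ 2 + B.
have kappa0 : 0 <= kappa by rewrite addr_ge0// sqr_ge0.
pose eta := (4 * (mu + 1))^-1.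
have mu1 : 0 < mu + 1 by rewrite addr_gt0.
have eta0 : 0 < eta by rewrite invr_gt0 mulr_gt0.
pose Q := 3 / nu + 1.
pose Z := Q * (2 * kappa + nu ^+ 2) + 3 * kappa / nu + 1.
pose P := 8 / (7 * nu) * Z + Q * nu / eta.
pose L := 1 / (mu * Q) + 4 / mu + 4 * nu * (mu + 1) / mu + 4 * kappa / mu.
have Q0 : 0 < Q by rewrite addr_gt0// divr_gt0.
have Z0 : 0 < Z.
  apply: ltr_wpDl => //; apply: addr_ge0.
    by apply: mulr_ge0; [exact: ltW|apply: addr_ge0; [exact: mulr_ge0|exact: sqr_ge0]].
  by apply: divr_ge0; [exact: mulr_ge0|exact: ltW].
have P0 : 0 < P.
  apply: addr_gt0; last by apply: divr_gt0 => //; exact: mulr_gt0.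
  by apply: mulr_gt0 => //; apply: divr_gt0 => //; exact: mulr_gt0.
have L0 : 0 < L.
  apply: ltr_wpDr; first by apply: divr_ge0; [exact: mulr_ge0|exact: ltW].
  apply: addr_gt0; last by apply: divr_gt0 => //; apply: mulr_gt0 => //; exact: mulr_gt0.
  by apply: addr_gt0; apply: divr_gt0 => //; exact: mulr_gt0.
exists P, Q, L; split => // T T0.
exists (fun t => P * v1 t + Q * (nu * (2 * L2ip (Wx t) (wxt t)) + de2 t) + mu * (2 * L2ip (Wxx t) (wxxt t))).
split.
  apply: primD; last exact: primZ (energy_wxx hmu hw0 hw hreg T0).
  apply: primD; first exact: primZ (V1_prim T0).
  apply: primZ; apply: primD (e2_prim T0).
  exact: primZ (energy_wx hmu hw0 hw hreg T0).
apply: aeS (aeI good_time v1_ineq) => t [Ht Hv] t0; have [Hwt cwt pde] := Ht t0.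
have Hf := extend0_H2 hw0 hreg (ltW t0); have Pf := W_prim hw0 hw hreg (ltW t0).
have hS x : 0 < x <= 1 -> W t x ^+ 2 <= B by apply: hB; exact: ltW.
have [Lw Lwx _] := extend0_L2 hw0 hreg (ltW t0).
have j1 := decay_ineq1 hmu hnu halpha0 k00 k10 i00 i10 (N1_ge0 t) r1 r2 r3
  (H1_poincare Lw Lwx Pf) (Hv t0).
have j2 := energy_ineq2 hnu hc0 hc1 Hf Pf Hwt cwt pde hS.
have j3 := energy_ineq3 hnu Hf Pf Hwt pde hS.
have j4 := energy_ineq4 hmu Hf Pf Hwt pde hS.
have j1' : v1 t + 2 * alpha * V1 t <= - (7 / 8 * nu * N1 t) - eta * e1 t.
  by rewrite (mulrC eta); exact: j1.
by apply: (decay_ineq (M0 := L2ip (wt t) (wt t)) hmu hnu halpha0 kappa0 eta0 r1 (e1_ge0 t)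
  (e2_le_e1 t) (e3_ge0 t) (N1_ge0 t) (L2ip_ge0 _) (L2ip_ge0 _) (L2ip_ge0 _)
  (L2ip_ge0 _) j1' j2 j3 j4).
Qed.

Let E1E : E1 wd c0 c1 w 0 = e1 0.
Proof.
rewrite /e1 /E1 !(extend0_w hw)// ?lexx ?ler01//.
by field; rewrite !gt_eqF.
Qed.

Let E3E t : 0 < t -> E3 wd c0 c1 w wt t = e3 t.
Proof.
move=> t0; rewrite /e3 /E3 !extend0_gt0//.
by field; rewrite !gt_eqF.
Qed.

Let dissipation t : \bar R := (expR (2 * alpha * t))%:E *
  (L2sq (wxt t) + mu%:E * L2sq (wxxt t) + (2 / nu * E3 wd c0 c1 w wt t)%:E).

Let dissipation_measurable T : measurable_fun (`]0, T] : set R) dissipation.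
Proof.
have [mj _ _] := sr_measurable hreg; have [m1 m2 m3] := sr_measurable_t hreg.
have slice u x : jointly_measurable u -> 0 <= x <= 1 ->
    measurable_fun (`]0, T] : set R) (fun t => u t x).
  move=> mu' x01; apply: measurable_funS (jointly_measurable_time x01 mu') => //.
  by move=> t /=; rewrite !in_itv /= andbT => /andP[].
have x0 : (0 : R) <= (0 : R) <= (1 : R) by rewrite lexx ler01.
have x1 : (0 : R) <= (1 : R) <= (1 : R) by rewrite lexx ler01.
apply: emeasurable_funM.
  apply/measurable_EFinP; apply: measurable_funTS.
  apply: continuous_measurable_fun => s; apply: continuous_comp; last exact: continuous_expR.
  by apply: cvgM; [exact: cvg_cst|exact: cvg_id].
apply: emeasurable_funD.
  apply: emeasurable_funD; first exact: L2sq_measurable.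
  by apply: measurable_funeM; exact: L2sq_measurable.
apply/measurable_EFinP; apply: measurable_funM => //.
by apply: measurable_funD; apply: measurable_funM; do ?apply: measurable_funX;
  do ?[apply: measurable_funD => //|apply: measurable_funM => //|apply: measurable_funX];
  exact: slice.
Qed.

Let dissipation_bound : exists2 C : R, 0 < C & forall t, 0 < t ->
  (nu%:E * L2sq (wxx t)
   + (expR (- (2 * alpha * t)))%:E * \int[leb]_(s in `[0%R, t]) dissipation s
   <= (expR (- (2 * alpha * t)) * (C * (N0 0 + N1 0 + N2 0 + e1 0)))%:E)%E.
Proof.
have [P [Q [L [P0 Q0 L0 H]]]] := lyapunov.
(* One summand for each part of V, so that [V 0] is at most [C0] times the initial energy. The
   factor [nu / mu + L] below combines the bound on w_xx at time t with the bound on the dissipation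
   integral. *)
pose C0 := P * (1 + mu + mu / nu) + Q * (nu + 1) + mu.
have C00 : 0 < C0.
  apply: addr_gt0 => //; apply: addr_gt0; apply: mulr_gt0 => //; last exact: addr_gt0.
  by apply: addr_gt0; [exact: addr_gt0|exact: divr_gt0].
exists ((nu / mu + L) * C0).
  by apply: mulr_gt0 => //; apply: addr_gt0 => //; exact: divr_gt0.
move=> t t0; have [v [HV Hv]] := H t t0.
set V := fun t => P * V1 t + Q * (nu * N1 t + e2 t) + mu * N2 t in HV Hv.
(* Minus the derivative of [exp (2 alpha s) V s], so its integral is the drop of that weighted
   functional. *)
pose p s := - (expR (2 * alpha * s) * (v s + 2 * alpha * V s)).
have HE := prim_expR_mul (2 * alpha) (ltW t0) HV.
have Ip : itg 0 t p by apply: itgN; case: HE.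
have pE : pint 0 t p = V 0 - expR (2 * alpha * t) * V t.
  rewrite /p pintN; last by case: HE.
  have [_ <- //] := HE; last exact: ltW.
  by rewrite mulr0 expR0 mul1r opprB.
have Dp : {ae leb, forall s, 0 < s <= t -> 0 <= L * p s /\ (dissipation s <= (L * p s)%:E)%E}.
  have [L1 L2 L3] := in_H1_ae_L2 hreg.
  apply: aeS (aeI Hv (aeI L2 L3)) => s [h [h2 h3]] /andP[s0 _].
  have Lxt := h2 s0; have Lxxt := h3 s0; have {}h := h s0.
  have ex0 := expR_gt0 (2 * alpha * s).
  have -> : L * p s = expR (2 * alpha * s) * (L * - (v s + 2 * alpha * V s)).
    by rewrite /p; ring.
  have D0 : 0 <= L2ip (wxt s) (wxt s) + mu * L2ip (wxxt s) (wxxt s) + 2 / nu * e3 s.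
    apply: addr_ge0; last by apply: mulr_ge0 => //; apply: divr_ge0 => //; exact: ltW.
    by apply: addr_ge0; [|apply: mulr_ge0; [exact: ltW|]]; exact: L2ip_ge0.
  split; first by apply: mulr_ge0; [exact: ltW|exact: le_trans h].
  rewrite /dissipation E3E// !L2sqE// -(EFinM mu) -!EFinD -EFinM lee_fin.
  by apply: ler_wpM2l; [exact: ltW|exact: h].
have ILp : itg 0 t (fun s => L * p s) by exact: itgZ.
have Lp0 : 0 <= L * pint 0 t p.
  rewrite -pintZ//; apply: (@le_trans _ _ (pint 0 t (fun=> 0))).
    by rewrite pint_cst ?mul0r// ltW.
  apply: pint_ae_le => //; first exact: itg_cst.
  by apply: aeS Dp => s h /h[].
have Ibound : (\int[leb]_(s in `[0%R, t]) dissipation s <= (L * pint 0 t p)%:E)%E.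
  rewrite -integral_itv_obnd_cbnd; last exact: dissipation_measurable.
  have In := itg_norm ILp.
  (* [L * p] is nonnegative only almost everywhere; its absolute value is a majorant that is
     nonnegative at every time. *)
  apply: (@le_trans _ _ (\int[leb]_(s in `]0%R, t]) (`|L * p s|)%:E)%E).
    apply: ae_ge0_le_integral => //.
    - move=> s /=; rewrite in_itv /= => /andP[s0 _]; rewrite /dissipation E3E//.
      apply: mule_ge0; first by rewrite lee_fin expR_ge0.
      apply: adde_ge0; last by rewrite lee_fin mulr_ge0// divr_ge0// ltW.
      by apply: adde_ge0; [exact: L2sq_ge0|exact: muL2sq_ge0].
    - exact: dissipation_measurable.
    - by apply/measurable_EFinP; exact: itg_meas In.
    - apply: aeS Dp => s h; rewrite /= in_itv /= => /h[h1 h2].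
      by rewrite ger0_norm.
  rewrite -pintZ// -(@pint_ae_eq _ 0 t (fun s => `|L * p s|)).
  - by rewrite /pint /Rintegral fineK//; exact: integrable_fin_num In.
  - exact: itg_meas In.
  - exact: itg_meas ILp.
  - by apply: aeS Dp => s h /h[h1 _]; rewrite ger0_norm.
have Lxx : in_L2 (wxx t) by have [_ [_ + _]] := sr_H2 hreg t0.
have ex0 := expR_gt0 (- (2 * alpha * t)).
have exE : expR (- (2 * alpha * t)) * expR (2 * alpha * t) = 1.
  by rewrite -expRD addNr expR0.
apply: (@le_trans _ _ ((nu * N2 t)%:E + (expR (- (2 * alpha * t)) * (L * pint 0 t p))%:E)%E).
  apply: leeD; first by rewrite L2sqE// -EFinM /N2 extend0_gt0.
  by rewrite EFinM; apply: lee_wpmul2l => //; rewrite lee_fin ltW.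
rewrite -EFinD lee_fin.
have n0 s : 0 <= N0 s := L2ip_ge0 _.
have n2 s : 0 <= N2 s := L2ip_ge0 _.
have VN2 : mu * N2 t <= V t.
  rewrite /V lerDr; apply: addr_ge0; apply: mulr_ge0; try exact: ltW.
    apply: addr_ge0; last by apply: mulr_ge0 => //; apply: divr_ge0; exact: ltW.
    by apply: addr_ge0 => //; apply: mulr_ge0 => //; exact: ltW.
  by apply: addr_ge0 => //; apply: mulr_ge0 => //; exact: ltW.
have V0E : V 0 <= C0 * (N0 0 + N1 0 + N2 0 + e1 0).
  have q1 : V1 0 <= (1 + mu + mu / nu) * (N0 0 + N1 0 + N2 0 + e1 0).
    have d0 : 0 <= mu / nu by apply: divr_ge0; exact: ltW.
    have := mulr_ge0 (ltW hmu) (n0 0); have := mulr_ge0 (ltW hmu) (n2 0).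
    have := mulr_ge0 (ltW hmu) (e1_ge0 0).
    have := mulr_ge0 d0 (n0 0); have := mulr_ge0 d0 (n2 0); have := mulr_ge0 d0 (N1_ge0 0).
    have := n2 0; have := N1_ge0 0; have := e1_ge0 0; rewrite /V1; lra.
  have q2 : nu * N1 0 + e2 0 <= (nu + 1) * (N0 0 + N1 0 + N2 0 + e1 0).
    have := e2_le_e1 0; have := mulr_ge0 (ltW hnu) (n0 0).
    have := mulr_ge0 (ltW hnu) (n2 0); have := mulr_ge0 (ltW hnu) (e1_ge0 0).
    have := n0 0; have := n2 0; have := N1_ge0 0; lra.
  have q3 : mu * N2 0 <= mu * (N0 0 + N1 0 + N2 0 + e1 0).
    apply: ler_wpM2l; first exact: ltW.
    have := n0 0; have := N1_ge0 0; have := e1_ge0 0; lra.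
  have := ler_wpM2l (ltW P0) q1; have := ler_wpM2l (ltW Q0) q2.
  rewrite /V /C0; lra.
set I0 := N0 0 + N1 0 + N2 0 + e1 0 in V0E *.
have eV : V t <= expR (- (2 * alpha * t)) * V 0.
  have : 0 <= pint 0 t p by move: Lp0; rewrite pmulr_rge0.
  rewrite pE => h; have := mulr_ge0 (ltW ex0) h.
  by rewrite mulrBr mulrA exE mul1r subr_ge0.
have Vt0 : 0 <= V t by apply: le_trans VN2; apply: mulr_ge0 => //; exact: ltW.
have t1 : nu * N2 t <= nu / mu * (expR (- (2 * alpha * t)) * V 0).
  have -> : nu * N2 t = nu / mu * (mu * N2 t) by field; rewrite gt_eqF.
  apply: ler_wpM2l; first by apply: divr_ge0; exact: ltW.
  exact: le_trans eV.
have t2 : expR (- (2 * alpha * t)) * (L * pint 0 t p) <= L * (expR (- (2 * alpha * t)) * V 0).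
  rewrite mulrCA; apply: ler_wpM2l; first exact: ltW.
  by apply: ler_wpM2l; [exact: ltW|rewrite pE gerBl mulr_ge0// expR_ge0].
apply: (le_trans (lerD t1 t2)); rewrite -mulrDl mulrCA -(mulrA _ C0).
apply: ler_wpM2l; first exact: ltW.
by apply: ler_wpM2l => //; apply: addr_ge0; [apply: divr_ge0|]; exact: ltW.
Qed.

Let initial_energyE : (H2sq w0 w0x w0xx + (E1 wd c0 c1 w 0)%:E =
  (N0 0 + N1 0 + N2 0 + e1 0)%:E)%E.
Proof.
have [[L0 L1 _] [_ L2 _]] := hw0.
by rewrite /H2sq !L2sqE// E1E -!EFinD /N0 /N1 /N2 !extend0_0.
Qed.

Lemma weighted_estimate : exists C I0 : R, [/\ 0 < C, 0 <= I0,
  (H2sq w0 w0x w0xx + (E1 wd c0 c1 w 0)%:E = I0%:E)%E &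
  forall t, 0 < t -> (nu%:E * L2sq (wxx t)
    + (expR (- (2 * alpha * t)))%:E
      * \int[leb]_(s in `[0%R, t])
          ((expR (2 * alpha * s))%:E
           * (L2sq (wxt s) + mu%:E * L2sq (wxxt s)
              + (2 / nu * E3 wd c0 c1 w wt s)%:E))
    <= (expR (- (2 * alpha * t)) * (C * I0))%:E)%E].
Proof.
have [C C0 hC] := dissipation_bound.
exists C, (N0 0 + N1 0 + N2 0 + e1 0).
split; [by []| |exact: initial_energyE|exact: hC].
by apply: addr_ge0 => //; do 2?apply: addr_ge0; exact: L2ip_ge0.
Qed.

End ClosedLoopDecay.

Unset Implicit Arguments.

Theorem lemma2p5 (R : realType) (mu nu wd c0 c1 alpha : R)
  (hmu : 0 < mu) (hnu : 0 < nu) (hwd : 0 <= wd) (hc0 : 0 < c0) (hc1 : 0 < c1)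
  (halpha0 : 0 <= alpha) (halpha : alpha <= decay_rate_bound mu nu wd c0 c1)
  (w0 w0x w0xx : R -> R) (hw0 : in_H2 w0 w0x w0xx)
  (w wx wxx wt wxt wxxt : R -> R -> R)
  (hw : weak_solution mu nu wd c0 c1 w0 w wx wt wxt)
  (hreg : standing_regularity mu w wx wxx wt wxt wxxt) :
  exists C : R, 0 < C /\ forall t : R, 0 < t ->
    (nu%:E * L2sq (wxx t)
     + (expR (- (2 * alpha * t)))%:E
       * \int[lebesgue_measure]_(s in `[0%R, t])
           ((expR (2 * alpha * s))%:E
            * (L2sq (wxt s) + mu%:E * L2sq (wxxt s)
               + (2 / nu * E3 wd c0 c1 w wt s)%:E))
     <= (C * expR C * expR (- (2 * alpha * t)))%:E
        * ((C * (1 + mu))%:E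
           * (H2sq w0 w0x w0xx + (E1 wd c0 c1 w 0)%:E)))%E.
Proof.
have [C [I0 [C0 I00 I0E hC]]] :=
  weighted_estimate hmu hnu hwd hc0 hc1 halpha0 halpha hw0 hw hreg.
(* With [1 + C] in place of [C], the extra factors [expR (1 + C)], [1 + C] and [1 + mu] of the
   stated form are all at least 1. *)
exists (1 + C); split; first by rewrite addr_gt0.
move=> t t0; apply: (le_trans (hC t t0)).
rewrite I0E -!EFinM lee_fin.
have ex0 := expR_gt0 (- (2 * alpha * t)).
have eC : 1 <= expR (1 + C) by rewrite -expR0 ler_expR addr_ge0// ltW.
have -> : (1 + C) * expR (1 + C) * expR (- (2 * alpha * t)) * ((1 + C) * (1 + mu) * I0) =
    expR (- (2 * alpha * t)) * ((1 + C) * (expR (1 + C) * (1 + C) * (1 + mu)) * I0) by ring.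
apply: ler_wpM2l; first exact: ltW.
apply: ler_wpM2r => //; apply: (@le_trans _ _ (1 + C)); first by rewrite lerDr.
have C1 : 1 <= 1 + C by rewrite lerDl ltW.
rewrite ler_peMr ?(le_trans ler01 C1)// mulr_ege1 ?mulr_ege1//.
by rewrite lerDl ltW.
Qed.
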